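(* Let $k$ be an algebraically closed field of characteristic $p>0$, let $r \geq 1$, and set $q = p^r$. Let $G = SL_2$ over $k$ and let $U \cong \mathbb{G}_a$ be the unipotent radical of a Borel subgroup $B$ of $G$ (with $B$, and the isomorphism $U \cong \mathbb{G}_a$, defined over $\mathbb{F}_p$). Let $f : U \to U$ be the homomorphism of algebraic groups given, under $U \cong \mathbb{G}_a$, by the polynomial $f(t) = t - t^q$, and let $M = f^*(\mathrm{St}_r)$ be the rational $U$-module obtained from the $r$-th Steinberg module $\mathrm{St}_r$ by precomposing the structure map $U \to GL(\mathrm{St}_r)$ with $f$. Then $M$ is projective as a module for the $r$-th Frobenius kernel $U_r$, but $M$ is trivial as a $U(\mathbb{F}_q)$-module. In particular, a finite-dimensional rational $U$-module that is projective over $U_r$ need not be projective over $kU(\mathbb{F}_q)$.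
   Context: $\mathrm{St}_r$ is the $r$-th Steinberg module for $SL_2$: the simple rational $SL_2$-module of highest weight $q-1 = p^r-1$, of dimension $q$. $U_r$ is the $r$-th Frobenius kernel of $U$ (under $U\cong\mathbb{G}_a$, the subgroup scheme with coordinate ring $k[t]/(t^{q})$), and $U(\mathbb{F}_q) \cong (\mathbb{F}_q,+)$ is the finite group of $\mathbb{F}_q$-rational points of $U$. A $U_r$-module is projective if it is projective over the finite-dimensional algebra $\mathrm{Dist}(U_r) = k[U_r]^*$. A module is trivial for a group if every group element acts as the identity. *)

(* Defs.v *)
From HB Require Import structures.
From mathcomp Require Import all_boot all_order all_fingroup all_algebra.
From mathcomp Require Import boolp mpoly ring zify.

Set Implicit Arguments.
Unset Strict Implicit.
Unset Printing Implicit Defensive.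

Import GRing.Theory.
Local Open Scope ring_scope.

Definition projective (R : pzRingType) (P : lmodType R) : Prop :=
  forall (N N' : lmodType R) (g : {linear N -> N'}) (h : {linear P -> N'}),
    (forall y, exists x, g x = y) ->
    exists h' : {linear P -> N}, forall x, g (h' x) = h x.

(* Affine algebraic groups over the algebraically closed field k are      *)
(* identified with their groups of k-points. The ambient affine space is  *)
(* 'M[k]_2, with coordinates indexed through mxvec.                       *)
Section AlgebraicGroups.
Variable k : closedFieldType.
Local Notation mpol := {mpoly k[(2 * 2)%N]}.

Definition mxeval (g : 'M[k]_2) (P : mpol) : k := P.@[fun i => mxvec g 0 i].

Definition coordX : 'M[mpol]_2 := \matrix_(i, j) 'X_(mxvec_index i j).

Definition mateval m n (F : 'M[mpol]_(m, n)) (g : 'M[k]_2) : 'M[k]_(m, n) :=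
  map_mx (mxeval g) F.

Definition zariski_closed (Z : 'M[k]_2 -> Prop) : Prop :=
  exists S : mpol -> Prop,
    forall g, Z g <-> (forall P, S P -> mxeval g P = 0).

Record closed_subgroup := ClosedSubgroup {
  cs_set :> 'M[k]_2 -> Prop;
  cs_closed : zariski_closed cs_set;
  cs_det : forall g, cs_set g -> \det g = 1;
  cs_one : cs_set 1%:M;
  cs_mul : forall g h, cs_set g -> cs_set h -> cs_set (g *m h);
  cs_inv : forall g, cs_set g -> cs_set (invmx g)
}.

Definition connected (Z : 'M[k]_2 -> Prop) : Prop :=
  forall Z1 Z2, zariski_closed Z1 -> zariski_closed Z2 ->
    (forall g, Z g -> Z1 g \/ Z2 g) ->
    (forall g, Z g -> ~ (Z1 g /\ Z2 g)) ->
    (forall g, Z g -> Z1 g) \/ (forall g, Z g -> Z2 g).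

(* The subgroup generated by the commutators. *)
Definition derived (D : 'M[k]_2 -> Prop) (g : 'M[k]_2) : Prop :=
  forall K : 'M[k]_2 -> Prop,
    K 1%:M -> (forall x y, K x -> K y -> K (x *m y)) ->
    (forall x, K x -> K (invmx x)) ->
    (forall x y, D x -> D y -> K (x *m y *m invmx x *m invmx y)) -> K g.

Definition solvable (D : 'M[k]_2 -> Prop) : Prop :=
  exists n, forall g, iter n derived D g -> g = 1%:M.

Definition borel (B : closed_subgroup) : Prop :=
  [/\ connected B, solvable B &
      forall B' : closed_subgroup, connected B' -> solvable B' ->
        (forall g, B g -> B' g) -> forall g, B' g -> B g].

Definition unipotent (D : 'M[k]_2 -> Prop) : Prop :=
  forall g, D g -> exists n, (g - 1%:M) ^+ n = 0.

Definition normal_in (V B : closed_subgroup) : Prop :=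
  (forall g, V g -> B g) /\
  (forall g h, V g -> B h -> V (h *m g *m invmx h)).

Definition unipotent_radical (B U : closed_subgroup) : Prop :=
  [/\ connected U, unipotent U, normal_in U B &
      forall V : closed_subgroup, connected V -> unipotent V ->
        normal_in V B -> forall g, V g -> U g].

(* The elements of the subfield with q elements, for q a power of the     *)
(* characteristic.                                                        *)
Definition Fq (q : nat) : {pred k} := [pred x | x ^+ q == x].

(* The ideal of Z is generated by its elements with coefficients in F. *)
Definition defined_over (F : {pred k}) (Z : 'M[k]_2 -> Prop) : Prop :=
  forall P : mpol, (forall g, Z g -> mxeval g P = 0) ->
    exists s : seq (mpol * mpol),
      P = \sum_(x <- s) x.1 * x.2 /\
      forall x, x \in s ->
        x.2 \is a mpolyOver (2 * 2) F /\ forall g, Z g -> mxeval g x.2 = 0.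

Lemma mateval_coordX g : mateval coordX g = g.
Proof. by apply/matrixP => i j; rewrite !mxE /mxeval mevalXU mxvecE. Qed.

Fact SL2_closed : zariski_closed (fun g => \det g = 1).
Proof.
exists (fun P => P = \det coordX - 1) => g.
have E : mxeval g (\det coordX - 1) = \det g - 1.
  rewrite /mxeval rmorphB rmorph1 /= -det_map_mx.
  by congr (\det _ - 1); exact: mateval_coordX.
split=> [dg P ->|/(_ _ erefl)]; first by rewrite E dg subrr.
by rewrite E => /eqP; rewrite subr_eq0 => /eqP.
Qed.

Definition SL2 : closed_subgroup.
Proof.
refine (@ClosedSubgroup (fun g => \det g = 1) SL2_closed _ _ _ _) => //.
- exact: det1.
- by move=> g h dg dh; rewrite det_mulmx dg dh mulr1.
- by move=> g dg; rewrite det_inv dg invr1.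
Defined.

Record group_morphism (H H' : closed_subgroup) := GroupMorphism {
  mor_coef : 'M[mpol]_2;
  mor_in : forall g, H g -> H' (mateval mor_coef g);
  mor_mul : forall g h, H g -> H h ->
    mateval mor_coef (g *m h) = mateval mor_coef g *m mateval mor_coef h
}.

(* A finite-dimensional rational H-module, in a basis: the left action of *)
(* H on column vectors, with matrix coefficients in k[H]; they are given  *)
(* by representatives in the coordinate ring of 'M_2, of which k[H] is a  *)
(* quotient.                                                              *)
Record rational_module (H : closed_subgroup) := RationalModule {
  rm_dim : nat;
  rm_coef : 'M[mpol]_rm_dim;
  rm_one : mateval rm_coef 1%:M = 1%:M;
  rm_mul : forall g h, H g -> H h ->
    mateval rm_coef (g *m h) = mateval rm_coef g *m mateval rm_coef h
}.

Definition rm_act H (M : rational_module H) (g : 'M[k]_2) : 'M[k]_(rm_dim M) :=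
  mateval (rm_coef M) g.

Definition inclusion (H H' : closed_subgroup) (sHH' : forall g, H g -> H' g) :
  group_morphism H H'.
Proof.
refine (@GroupMorphism H H' coordX _ _) => [g Hg|g h _ _].
  by rewrite mateval_coordX; apply: sHH'.
by rewrite !mateval_coordX.
Defined.

Definition subst_coef n (F : 'M[mpol]_n) (G : 'M[mpol]_2) : 'M[mpol]_n :=
  map_mx (comp_mpoly [tuple mxvec G 0 i | i < (2 * 2)%N]) F.

Lemma mateval_subst n (F : 'M[mpol]_n) G g :
  mateval (subst_coef F G) g = mateval F (mateval G g).
Proof.
apply/matrixP => i j; rewrite !mxE /mxeval comp_mpoly_meval.
by apply: meval_eq => l; rewrite tnth_mktuple /mateval -map_mxvec mxE.
Qed.

Lemma mor_one H H' (f : group_morphism H H') : mateval (mor_coef f) 1%:M = 1%:M.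
Proof.
have H1 := cs_one H; have := mor_mul f H1 H1; rewrite mulmx1 => /esym E.
have u1 : mateval (mor_coef f) 1%:M \in unitmx.
  by rewrite unitmxE (cs_det (mor_in f H1)) unitr1.
by have := congr1 (mulmx (invmx (mateval (mor_coef f) 1%:M))) E;
  rewrite mulKmx // mulVmx.
Qed.

Definition pullback H H' (f : group_morphism H H') (M : rational_module H') :
  rational_module H.
Proof.
refine (@RationalModule H _ (subst_coef (rm_coef M) (mor_coef f)) _ _).
  by rewrite mateval_subst mor_one rm_one.
move=> g h Hg Hh; rewrite !mateval_subst mor_mul //.
by apply: rm_mul; apply: mor_in.
Defined.

Definition torus (a : k) : 'M[k]_2 :=
  diag_mx (\row_(i < 2) if i == ord0 then a else a^-1).

Definition simple (M : rational_module SL2) : Prop :=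
  (0 < rm_dim M)%N /\
  forall W : {vspace 'cV[k]_(rm_dim M)},
    (forall g v, \det g = 1 -> v \in W -> rm_act M g *m v \in W) ->
    W = 0%VS \/ W = fullv.

Definition weight (M : rational_module SL2) (m : int) : Prop :=
  exists2 v : 'cV[k]_(rm_dim M), v != 0 &
    forall a : k, a != 0 -> rm_act M (torus a) *m v = (a ^ m) *: v.

(* Maximality is for the dominance order, the positive root being 2. *)
Definition highest_weight (M : rational_module SL2) (l : int) : Prop :=
  weight M l /\ forall m, weight M m -> exists n : nat, l = m + 2%:Z *+ n.

Definition steinberg (p r : nat) (M : rational_module SL2) : Prop :=
  simple M /\ highest_weight M (p ^ r).-1%:Z.

Definition param_at (A : 'M[{poly k}]_2) (t : k) : 'M[k]_2 :=
  map_mx (horner_eval t) A.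

(* An isomorphism of algebraic groups G_a -> U defined over F_p. *)
Record Ga_iso (p : nat) (U : closed_subgroup) := GaIso {
  ga_param : 'M[{poly k}]_2;
  ga_coord : mpol;
  ga_param_Fp : forall i j, ga_param i j \is a polyOver (Fq p);
  ga_coord_Fp : ga_coord \is a mpolyOver (2 * 2) (Fq p);
  ga_param_in : forall t, U (param_at ga_param t);
  ga_param_add : forall s t,
    param_at ga_param (s + t) = param_at ga_param s *m param_at ga_param t;
  ga_paramK : forall t, mxeval (param_at ga_param t) ga_coord = t;
  ga_coordK : forall g, U g -> param_at ga_param (mxeval g ga_coord) = g
}.

Section GaEndomorphisms.
Variables (p : nat) (U : closed_subgroup) (iso : Ga_iso p U).

Definition Ga_endo_coef (f : {poly k}) : 'M[mpol]_2 :=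
  map_mx (fun P : {poly k} => (map_poly (@mpolyC _ k) (P \Po f)).[ga_coord iso])
    (ga_param iso).

Lemma mateval_Ga_endo f g :
  mateval (Ga_endo_coef f) g =
  param_at (ga_param iso) f.[mxeval g (ga_coord iso)].
Proof.
apply/matrixP => i j; rewrite !mxE /horner_eval -horner_comp /mxeval.
rewrite -horner_map /= -map_poly_comp /=; congr (_.[_]).
by apply: map_poly_id => c _ /=; rewrite mevalC.
Qed.

(* The endomorphism of U that corresponds to the endomorphism t |-> f(t)  *)
(* of G_a.                                                                *)
Definition Ga_endo (f : {poly k}) (fD : forall s t, f.[s + t] = f.[s] + f.[t]) :
  group_morphism U U.
Proof.
refine (@GroupMorphism U U (Ga_endo_coef f) _ _) => [g _|g h Ug Uh].
  by rewrite mateval_Ga_endo; apply: ga_param_in.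
rewrite !mateval_Ga_endo -ga_param_add -fD; congr (param_at _ _.[_]).
by rewrite -{1}(ga_coordK iso Ug) -{1}(ga_coordK iso Uh) -ga_param_add ga_paramK.
Defined.

End GaEndomorphisms.

Definition frob (q : nat) (x : k) : k := x ^+ q.

Lemma pnat_q p r : p \in [pchar k] -> ([pchar k]).-nat (p ^ r)%N.
Proof.
move=> charp.
by rewrite (eq_pnat _ (pcharf_eq charp)) pnatX pnat_id ?(pcharf_prime charp).
Qed.

Definition artin_schreier_poly (q : nat) : {poly k} := 'X - 'X^q.

Lemma artin_schreier_add p r : p \in [pchar k] -> forall s t,
  (artin_schreier_poly (p ^ r)).[s + t] =
  (artin_schreier_poly (p ^ r)).[s] + (artin_schreier_poly (p ^ r)).[t].
Proof.
move=> charp s t; rewrite /artin_schreier_poly !hornerD !hornerN !hornerX.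
by rewrite !hornerXn exprDn_pchar ?pnat_q // opprD addrACA.
Qed.

Definition artin_schreier p (charp : p \in [pchar k]) (U : closed_subgroup)
    (iso : Ga_iso p U) (r : nat) : group_morphism U U :=
  Ga_endo iso (artin_schreier_add r charp).

(* H(F_q), for q = p ^ r. The two hypotheses are arguments so that the    *)
(* finite group structure below can be canonical.                         *)
Definition Fq_points p (_ : p \in [pchar k]) r (_ : (0 < r)%N)
    (H : closed_subgroup) : Type :=
  {g : 'M[k]_2 | `[< H g >] && [forall i, forall j, g i j \in Fq (p ^ r)]}.

Section FqPoints.
Variables (p : nat) (charp : p \in [pchar k]) (r : nat) (r_gt0 : (0 < r)%N).
Variable H : closed_subgroup.
Local Notation q := (p ^ r)%N.
Local Notation pts := (Fq_points charp r_gt0 H).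

HB.instance Definition _ := SubType.on pts.
HB.instance Definition _ := [Choice of pts by <:].

Let q_gt1 : (1 < q)%N.
Proof. by rewrite -(exp1n r) ltn_exp2r // prime_gt1 // (pcharf_prime charp). Qed.

Let Fq_roots : seq k := sval (closed_field_poly_normal ('X^q - 'X)).

Let mem_Fq_roots x : (x \in Fq_roots) = (x \in Fq q).
Proof.
rewrite /Fq_roots; case: closed_field_poly_normal => s /= E.
have nz : 'X^q - 'X != 0 :> {poly k}.
  rewrite -size_poly_eq0 size_polyDl ?size_polyXn //.
  by rewrite size_polyN size_polyX ltnS.
have : root ('X^q - 'X) x = (x \in s).
  by rewrite E rootZ ?lead_coef_eq0 // root_prod_XsubC.
by move=> <-; rewrite rootE !hornerE subr_eq0.
Qed.

Let to_mx (g : pts) : 'M[option (seq_sub Fq_roots)]_2 := map_mx insub (val g).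
Let of_mx (A : 'M[option (seq_sub Fq_roots)]_2) : option pts :=
  insub (map_mx (fun o => odflt 0 (omap val o)) A).

Let to_mxK : pcancel to_mx of_mx.
Proof.
move=> g; rewrite /of_mx (_ : map_mx _ _ = val g) ?valK //.
apply/matrixP => i j; rewrite !mxE insubT /= ?mem_Fq_roots //.
by have /andP[_ /forallP/(_ i)/forallP/(_ j)] := valP g.
Qed.

HB.instance Definition _ : isCountable pts := PCanIsCountable to_mxK.
HB.instance Definition _ : isFinite pts := PCanIsFinite to_mxK.

Let FqP (g : 'M[k]_2) :
  reflect (map_mx (frob q) g = g) [forall i, forall j, g i j \in Fq q].
Proof.
apply: (iffP forallP) => [Hg|Hg i].
  by apply/matrixP => i j; rewrite mxE; have /forallP/(_ j)/eqP := Hg i.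
by apply/forallP => j; rewrite inE; move/matrixP/(_ i j): Hg; rewrite mxE => /eqP.
Qed.

Let frob_zmod : zmod_morphism (frob q).
Proof.
move=> x y; apply/eqP; rewrite eq_sym subr_eq -exprDn_pchar ?pnat_q //.
by rewrite subrK.
Qed.
Let frob_monoid : monoid_morphism (frob q).
Proof. by split=> [|x y]; rewrite /frob ?expr1n ?exprMn. Qed.
#[local] HB.instance Definition _ := GRing.isZmodMorphism.Build k k (frob q) frob_zmod.
#[local] HB.instance Definition _ := GRing.isMonoidMorphism.Build k k (frob q) frob_monoid.

Let pt1P : `[< H 1%:M >] && [forall i, forall j, (1%:M : 'M[k]_2) i j \in Fq q].
Proof. by apply/andP; split; [apply/asboolP/cs_one | apply/FqP; rewrite map_mx1]. Qed.
Let ptMP (g h : pts) : `[< H (val g *m val h) >] &&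
  [forall i, forall j, (val g *m val h) i j \in Fq q].
Proof.
case/andP: (valP g) => /asboolP Hg /FqP Fg.
case/andP: (valP h) => /asboolP Hh /FqP Fh.
apply/andP; split; first by apply/asboolP/cs_mul.
by apply/FqP; rewrite map_mxM; congr (_ *m _).
Qed.
Let ptVP (g : pts) : `[< H (invmx (val g)) >] &&
  [forall i, forall j, (invmx (val g)) i j \in Fq q].
Proof.
case/andP: (valP g) => /asboolP Hg /FqP Fg.
apply/andP; split; first by apply/asboolP/cs_inv.
by apply/FqP; rewrite map_invmx; congr (invmx _).
Qed.

Definition Fq_one : pts := Sub 1%:M pt1P.
Definition Fq_mul (g h : pts) : pts := Sub (val g *m val h) (ptMP g h).
Definition Fq_inv (g : pts) : pts := Sub (invmx (val g)) (ptVP g).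

Let Fq_mulA : associative Fq_mul.
Proof. by move=> g h l; apply: val_inj; rewrite /= mulmxA. Qed.
Let Fq_mul1 : left_id Fq_one Fq_mul.
Proof. by move=> g; apply: val_inj; rewrite /= mul1mx. Qed.
Let Fq_mulV : left_inverse Fq_one Fq_inv Fq_mul.
Proof.
move=> g; apply: val_inj => /=; rewrite mulVmx // unitmxE.
by have /andP[/asboolP/cs_det -> _] := valP g; rewrite unitr1.
Qed.

HB.instance Definition _ := Finite_isGroup.Build pts Fq_mulA Fq_mul1 Fq_mulV.

Lemma Fq_points_in (g : pts) : H (val g).
Proof. by have /andP[/asboolP] := valP g. Qed.

End FqPoints.

End AlgebraicGroups.

Arguments SL2 {k}.

(* Functions G -> k under convolution: a stands for \sum_x a x * x. *)
Definition group_algebra (k : fieldType) (G : finGroupType) : Type :=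
  {ffun G -> k}.

Section GroupAlgebra.
Variables (k : fieldType) (G : finGroupType).
Local Notation kG := (group_algebra k G).
Implicit Types a b c : kG.

HB.instance Definition _ := GRing.Zmodule.on kG.

Definition galg_one : kG := [ffun x : G => (x == 1%g)%:R].
Definition galg_mul a b : kG := [ffun x : G => \sum_(y : G) a y * b (y^-1 * x)%g].

Let galg_mulA : associative galg_mul.
Proof.
move=> a b c; apply/ffunP => x; rewrite !ffunE.
under eq_bigr => y _ do rewrite ffunE mulr_sumr.
under [RHS]eq_bigr => z _ do rewrite ffunE mulr_suml.
rewrite [RHS]exchange_big; apply: eq_bigr => y _ /=.
rewrite [RHS](reindex_inj (mulgI y)); apply: eq_bigr => w _ /=.
by rewrite mulKg invMg !mulgA mulrA.
Qed.
Let galg_mul1 : left_id galg_one galg_mul.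
Proof.
move=> a; apply/ffunP => x; rewrite ffunE (bigD1 1%g) //= big1 => [|y ny].
  by rewrite ffunE eqxx mul1r invg1 mul1g addr0.
by rewrite ffunE (negPf ny) mul0r.
Qed.
Let galg_mulr1 : right_id galg_one galg_mul.
Proof.
move=> a; apply/ffunP => x; rewrite ffunE (bigD1 x) //= big1 => [|y ny].
  by rewrite ffunE mulVg eqxx mulr1 addr0.
rewrite ffunE -(inj_eq (mulgI y)) mulKVg mulg1 eq_sym (negPf ny) mulr0 //.
Qed.
Let galg_mulDl : left_distributive galg_mul +%R.
Proof.
move=> a b c; apply/ffunP => x; rewrite !ffunE -big_split.
by apply: eq_bigr => y _; rewrite ffunE mulrDl.
Qed.
Let galg_mulDr : right_distributive galg_mul +%R.
Proof.
move=> a b c; apply/ffunP => x; rewrite !ffunE -big_split.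
by apply: eq_bigr => y _; rewrite ffunE mulrDr.
Qed.

HB.instance Definition _ := GRing.Zmodule_isPzRing.Build kG
  galg_mulA galg_mul1 galg_mulr1 galg_mulDl galg_mulDr.

End GroupAlgebra.

Definition Fq_module (k : closedFieldType) p (charp : p \in [pchar k])
    r (r_gt0 : (0 < r)%N) (H : closed_subgroup k) (M : rational_module H) : Type :=
  'cV[k]_(rm_dim M).

Section FqModule.
Variables (k : closedFieldType) (p : nat) (charp : p \in [pchar k]).
Variables (r : nat) (r_gt0 : (0 < r)%N).
Variables (H : closed_subgroup k) (M : rational_module H).
Local Notation G := (Fq_points charp r_gt0 H).
Local Notation V := (Fq_module charp r_gt0 M).

HB.instance Definition _ := GRing.Zmodule.on V.

Definition Fq_scale (a : group_algebra k G) (v : V) : V :=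
  \sum_(g : G) a g *: (rm_act M (val g) *m v).

Let Fq_scaleA a b v : Fq_scale a (Fq_scale b v) = Fq_scale (a * b) v.
Proof.
rewrite /Fq_scale; under [RHS]eq_bigr => x _ do rewrite ffunE scaler_suml.
rewrite [RHS]exchange_big; apply: eq_bigr => y _ /=.
rewrite mulmx_sumr scaler_sumr [RHS](reindex_inj (mulgI y)).
apply: eq_bigr => z _; rewrite mulKg -scalemxAr mulmxA scalerA.
by rewrite -rm_mul //; apply: Fq_points_in.
Qed.
Let Fq_scale1 : left_id 1 Fq_scale.
Proof.
move=> v; rewrite /Fq_scale (bigD1 1%g) //= big1 => [|g ng].
  by rewrite ffunE eqxx scale1r /rm_act rm_one mul1mx addr0.
by rewrite ffunE (negPf ng) scale0r.
Qed.
Let Fq_scaleDr : right_distributive Fq_scale +%R.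
Proof.
move=> a v w; rewrite /Fq_scale -big_split; apply: eq_bigr => g _.
by rewrite mulmxDr scalerDr.
Qed.
Let Fq_scaleDl v : {morph Fq_scale^~ v : a b / a + b}.
Proof.
move=> a b; rewrite /Fq_scale -big_split; apply: eq_bigr => g _.
by rewrite ffunE scalerDl.
Qed.

HB.instance Definition _ := GRing.Zmodule_isLmodule.Build (group_algebra k G) V
  Fq_scaleA Fq_scale1 Fq_scaleDr Fq_scaleDl.

End FqModule.

Lemma sum_pick (V : nmodType) q (s : nat) (F : nat -> V) :
  ((q <= s)%N -> F s = 0) ->
  \sum_(n < q) (if s == n :> nat then F n else 0) = F s.
Proof.
case: ltnP => [lt_sq _|le_qs -> //]; last first.
  by apply: big1 => n _; case: eqP => // E; have := ltn_ord n; lia.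
by rewrite -big_mkcond (big_pred1 (Ordinal lt_sq)).
Qed.

(* The dual of the Hopf algebra k[t]/(t^q), where q is a power of the     *)
(* characteristic and t is primitive. A functional mu is recorded by its  *)
(* values mu i = mu(t^i), and the product is the convolution given by     *)
(* the coproduct of t^m, i.e. (t (x) 1 + 1 (x) t)^m.                      *)
Definition dist_algebra (k : fieldType) (q : nat) : Type := {ffun 'I_q -> k}.

Section DistAlgebra.
Variables (k : fieldType) (q : nat).
Local Notation D := (dist_algebra k q).
Implicit Types a b c : D.

HB.instance Definition _ := GRing.Zmodule.on D.

Definition dist_one : D := [ffun m : 'I_q => (m == 0 :> nat)%:R].
Definition dist_mul a b : D :=
  [ffun m : 'I_q =>
    \sum_(i < q) \sum_(j < q | (i + j)%N == m) (a i * b j) *+ 'C(m, i)].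

Let multinom_eq (i j l : nat) :
  ('C(j + l, j) * 'C(i + (j + l), i) =
   'C(i + j, i) * 'C(i + j + l, i + j))%N.
Proof.
have f0 : (0 < i`! * (j`! * l`!))%N by rewrite !muln_gt0 !fact_gt0.
apply/eqP; rewrite -(eqn_pmul2r f0); apply/eqP.
have fact_add x y : ('C(x + y, x) * (x`! * y`!) = (x + y)`!)%N.
  by rewrite -{2}(addKn x y) bin_fact // leq_addr.
transitivity ((i + j + l)`!).
  rewrite -[in RHS]addnA -(fact_add i) -(fact_add j); ring.
by rewrite -(fact_add (i + j)%N) -(fact_add i); ring.
Qed.

Let dist_mulA : associative dist_mul.
Proof.
move=> a b c; apply/ffunP => m; rewrite !ffunE.
pose T (x n : nat) (i j l : 'I_q) : k :=
  if (x + n == m)%N then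
    (a i * b j * c l) *+ ('C(j + l, j) * 'C(i + (j + l), i)) else 0.
transitivity (\sum_(i < q) \sum_(j < q) \sum_(l < q) T i (j + l)%N i j l).
  apply: eq_bigr => i _.
  transitivity (\sum_(n < q) \sum_(j < q) \sum_(l < q)
      (if (j + l == n)%N then T i n i j l else 0)).
    rewrite big_mkcond; apply: eq_bigr => n _ /=; rewrite /T; case: eqP => E.
      rewrite ffunE mulr_sumr -sumrMnl; apply: eq_bigr => j _.
      rewrite mulr_sumr -sumrMnl big_mkcond; apply: eq_bigr => l _ /=.
      by case: eqP => // ->; rewrite E mulrnAr mulrA -mulrnA.
    by rewrite big1 // => j _; rewrite big1 // => l _; rewrite if_same.
  rewrite exchange_big; apply: eq_bigr => j _ /=.
  rewrite exchange_big; apply: eq_bigr => l _ /=.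
  apply: (sum_pick (F := fun n => T i n i j l)) => le_q; rewrite /T.
  by case: eqP => // E; have := ltn_ord m; lia.
transitivity (\sum_(l < q) \sum_(i < q) \sum_(j < q) T (i + j)%N l i j l).
  rewrite [RHS]exchange_big; apply: eq_bigr => i _ /=.
  rewrite [RHS]exchange_big; apply: eq_bigr => j _ /=.
  by apply: eq_bigr => l _; rewrite /T addnA.
transitivity (\sum_(l < q) \sum_(n < q)
  (if (n + l == m)%N then (dist_mul a b n * c l) *+ 'C(m, n) else 0)).
  apply: eq_bigr => l _.
  transitivity (\sum_(n < q) \sum_(i < q) \sum_(j < q)
      (if (i + j == n)%N then T n l i j l else 0)).
    rewrite [RHS]exchange_big; apply: eq_bigr => i _ /=.
    rewrite [RHS]exchange_big; apply: eq_bigr => j _ /=.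
    apply/esym/(sum_pick (F := fun n => T n l i j l)) => le_q; rewrite /T.
    by case: eqP => // E; have := ltn_ord m; lia.
  apply: eq_bigr => n _; rewrite /T; case: eqP => E; last first.
    by rewrite big1 // => j _; rewrite big1 // => i _; rewrite if_same.
  rewrite ffunE mulr_suml -sumrMnl; apply: eq_bigr => i _.
  rewrite mulr_suml -sumrMnl [RHS]big_mkcond; apply: eq_bigr => j _ /=.
  by case: eqP => // En; rewrite multinom_eq En E mulrnAl -mulrnA.
by rewrite exchange_big; apply: eq_bigr => n _ /=; rewrite -big_mkcond.
Qed.

Let dist_mulC : commutative dist_mul.
Proof.
move=> a b; apply/ffunP => m; rewrite !ffunE.
under eq_bigr => i _ do rewrite big_mkcond.
rewrite exchange_big; apply: eq_bigr => i _ /=; rewrite [RHS]big_mkcond.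
apply: eq_bigr => j _; rewrite addnC; case: eqP => // E.
by rewrite mulrC -E -(bin_sub (leq_addr j i)) addKn.
Qed.

Let dist_mul1 : left_id dist_one dist_mul.
Proof.
move=> a; apply/ffunP => m; rewrite ffunE.
have q_gt0 : (0 < q)%N by exact: leq_ltn_trans (ltn_ord m).
rewrite (bigD1 (Ordinal q_gt0)) //= [X in _ + X]big1 => [|i ni].
  by rewrite (big_pred1 m) ?ffunE ?mul1r ?bin0 ?addr0.
rewrite big1 // => j _; rewrite ffunE.
have -> : (i == 0 :> nat) = false by apply/negbTE; move: ni; rewrite -(inj_eq val_inj).
by rewrite mul0r mul0rn.
Qed.

Let dist_mulDl : left_distributive dist_mul +%R.
Proof.
move=> a b c; apply/ffunP => m; rewrite !ffunE -big_split.
apply: eq_bigr => i _; rewrite -big_split; apply: eq_bigr => j _ /=.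
by rewrite ffunE mulrDl mulrnDl.
Qed.

HB.instance Definition _ := GRing.Zmodule_isComPzRing.Build D
  dist_mulA dist_mulC dist_mul1 dist_mulDl.

End DistAlgebra.

Section FrobeniusKernelModule.
Variables (k : closedFieldType) (p : nat) (charp : p \in [pchar k]).
Variables (U : closed_subgroup k) (iso : Ga_iso p U) (r : nat).
Variable M : rational_module U.
Local Notation n := (rm_dim M).
Local Notation q := (p ^ r)%N.

(* The matrix over k[G_a] = k[t] of the G_a-module M, through iso. *)
Definition Ga_coef : 'M[{poly k}]_n :=
  map_mx (mmap (@polyC k) (fun i => mxvec (ga_param iso) 0 i)) (rm_coef M).

Definition Ga_op (i : nat) : 'M[k]_n := map_mx (coefp i) Ga_coef.

Lemma Ga_coefE t :
  map_mx (horner_eval t) Ga_coef = rm_act M (param_at (ga_param iso) t).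
Proof.
apply/matrixP => a b; rewrite !mxE /mxeval /horner_eval.
elim/mpolyind: (rm_coef M a b) => [|c m P _ _ IH].
  by rewrite !raddf0 horner0.
rewrite !raddfD /= hornerD IH; congr (_ + _).
rewrite mmapZ mevalZ mmapX mevalX hornerM hornerC; congr (_ * _).
rewrite /mmap1 horner_prod; apply: eq_bigr => i _.
by rewrite horner_exp /param_at -map_mxvec mxE.
Qed.

Let polyext (P Q : {poly k}) : (forall t, P.[t] = Q.[t]) -> P = Q.
Proof.
move=> E; apply/eqP; rewrite -subr_eq0; apply/negPn/negP => /closed_nonrootP[x].
by rewrite rootE hornerD hornerN E subrr eqxx.
Qed.

Lemma Ga_op0 : Ga_op 0 = 1%:M.
Proof.
have U1 := cs_one U.
have E : param_at (ga_param iso) 0 = 1%:M.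
  have := ga_param_add iso 0 0; rewrite addr0 => E.
  have u0 : param_at (ga_param iso) 0 \in unitmx.
    by rewrite unitmxE (cs_det (ga_param_in iso 0)) unitr1.
  have := congr1 (mulmx (invmx (param_at (ga_param iso) 0))) E.
  by rewrite mulKmx // mulVmx.
have := Ga_coefE 0; rewrite E /rm_act rm_one => <-.
by apply/matrixP => a b; rewrite !mxE /= /horner_eval horner_coef0.
Qed.

Lemma Ga_op_mul i j : Ga_op i *m Ga_op j = 'C(i + j, i)%:R *: Ga_op (i + j).
Proof.
have AD s t : map_mx (horner_eval (s + t)) Ga_coef =
    map_mx (horner_eval s) Ga_coef *m map_mx (horner_eval t) Ga_coef.
  by rewrite !Ga_coefE ga_param_add; apply: rm_mul; apply: ga_param_in.
rewrite /Ga_op; move: Ga_coef AD => A AD.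
apply/matrixP => a b; rewrite !mxE /=.
set P := A a b.
have E : P^`N(j) = \sum_c (A c b)`_j *: A a c.
  apply: polyext => t.
  pose N := maxn (size P) (j.+1).
  pose L := \poly_(l < N) P^`N(l).[t].
  have EL : L = \sum_c (A a c).[t] *: A c b.
    apply: polyext => s; have /matrixP/(_ a b) := AD t s.
    rewrite !mxE /horner_eval horner_poly.
    have tay := nderiv_taylor_wide (mulrC t s) (leq_maxl (size P) j.+1).
    rewrite -/P tay => ->; rewrite horner_sum; apply: eq_bigr => c _.
    by rewrite !mxE hornerZ.
  have := congr1 (fun Q : {poly k} => Q`_j) EL.
  rewrite /L coef_poly leq_max leqnn orbT => ->.
  rewrite coef_sum horner_sum; apply: eq_bigr => c _.
  by rewrite coefZ hornerZ mulrC.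
have := congr1 (fun Q : {poly k} => Q`_i) E.
rewrite coef_nderivn coef_sum addnC /= => EP.
rewrite mulr_natl -[in RHS](bin_sub (leq_addr j i)) addKn EP.
by apply: eq_bigr => c _; rewrite !mxE /= coefZ mulrC.
Qed.

Lemma bin_char0 i j : (i < q)%N -> (j < q)%N -> (q <= i + j)%N ->
  'C(i + j, i)%:R = 0 :> k.
Proof.
move=> iq jq qij.
have E : (1 + 'X) ^+ (i + j) = (1 + 'X^q) * (1 + 'X) ^+ (i + j - q) :> {poly k}.
  rewrite -{1}(subnKC qij) exprD; congr (_ * _).
  rewrite exprDn_pchar ?expr1n // (eq_pnat _ (pchar_poly k)).
  exact: pnat_q.
have coef1X m l : ((1 + 'X) ^+ m : {poly k})`_l = 'C(m, l)%:R.
  rewrite exprDn coef_sum; under eq_bigr => x _ do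
    rewrite expr1n mul1r coefMn coefXn.
  rewrite -(sum_pick (q := m.+1) (s := l) (F := fun l => 'C(m, l)%:R)); last first.
    by move=> lt_ml; rewrite bin_small.
  by apply: eq_bigr => x _; case: eqP => // _; rewrite mul0rn.
have := congr1 (fun Q : {poly k} => Q`_i) E.
rewrite coef1X mulrDl mul1r coefD coef1X (@bin_small (i + j - q)); last by lia.
by rewrite coefXnM iq addr0.
Qed.

End FrobeniusKernelModule.

(* The k[t]/(t^q)-comodule deduced from the k[t]-comodule M, for q = p ^ r *)
(* and U identified with G_a, viewed as a left module over the dual        *)
(* algebra: mu acts through (id (x) mu) composed with the coaction.        *)
Definition Ur_module (k : closedFieldType) p (charp : p \in [pchar k])
    (U : closed_subgroup k) (iso : Ga_iso p U) (r : nat)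
    (M : rational_module U) : Type := 'cV[k]_(rm_dim M).

Section UrModule.
Variables (k : closedFieldType) (p : nat) (charp : p \in [pchar k]).
Variables (U : closed_subgroup k) (iso : Ga_iso p U) (r : nat).
Variable M : rational_module U.
Local Notation D := (dist_algebra k (p ^ r)).
Local Notation V := (Ur_module charp iso r M).

HB.instance Definition _ := GRing.Zmodule.on V.

Definition Ur_scale (mu : D) (v : V) : V :=
  \sum_(i < p ^ r) mu i *: (Ga_op iso M i *m v).

Let Ur_scaleA a b v : Ur_scale a (Ur_scale b v) = Ur_scale (a * b) v.
Proof.
pose W := 'cV[k]_(rm_dim M).
pose T n (i j : 'I_(p ^ r)) : W :=
  ((a i * b j) *+ 'C(n, i)) *: (Ga_op iso M n *m v).
transitivity (\sum_(i < p ^ r) \sum_(j < p ^ r) T (i + j)%N i j).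
  apply: eq_bigr => i _; rewrite mulmx_sumr scaler_sumr; apply: eq_bigr => j _.
  rewrite -scalemxAr mulmxA Ga_op_mul -scalemxAl !scalerA /T.
  by rewrite mulr_natr mulrnAr.
transitivity (\sum_(n < p ^ r) \sum_(i < p ^ r) \sum_(j < p ^ r)
    (if (i + j == n)%N then T n i j else 0)).
  rewrite [RHS]exchange_big; apply: eq_bigr => i _ /=.
  rewrite [RHS]exchange_big; apply: eq_bigr => j _ /=.
  apply/esym/(sum_pick (F := fun n => T n i j)) => le_q.
  by rewrite /T -mulr_natr (bin_char0 charp (r := r)) // mulr0 scale0r.
apply: eq_bigr => n _; rewrite ffunE scaler_suml; apply: eq_bigr => i _.
rewrite scaler_suml [RHS]big_mkcond; apply: eq_bigr => j _ /=.
by rewrite /T; case: eqP.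
Qed.

Let Ur_scale1 : left_id 1 Ur_scale.
Proof.
move=> v; have q_gt0 : (0 < p ^ r)%N.
  by rewrite expn_gt0 prime_gt0 // (pcharf_prime charp).
rewrite /Ur_scale (bigD1 (Ordinal q_gt0)) //= big1 => [|i ni].
  by rewrite ffunE /= scale1r Ga_op0 mul1mx addr0.
have -> : (1 : D) i = 0; last by rewrite scale0r.
by rewrite ffunE; move: ni; rewrite -(inj_eq val_inj) /= => /negPf ->.
Qed.

Let Ur_scaleDr : right_distributive Ur_scale +%R.
Proof.
move=> a v w; rewrite /Ur_scale -big_split; apply: eq_bigr => i _.
by rewrite mulmxDr scalerDr.
Qed.
Let Ur_scaleDl v : {morph Ur_scale^~ v : a b / a + b}.
Proof.
move=> a b; rewrite /Ur_scale -big_split; apply: eq_bigr => i _.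
by rewrite ffunE scalerDl.
Qed.

HB.instance Definition _ := GRing.Zmodule_isLmodule.Build D V
  Ur_scaleA Ur_scale1 Ur_scaleDr Ur_scaleDl.

End UrModule.

(* Main.v *)
Require Import Defs.
From mathcomp Require Import all_boot all_order all_fingroup all_algebra.
From mathcomp Require Import cyclic boolp mpoly ring zify.
From HB Require Import structures.

Set Implicit Arguments.
Unset Strict Implicit.
Unset Printing Implicit Defensive.

Import GRing.Theory.
Local Open Scope ring_scope.

(* Modulo t^q the endomorphism f(t) = t - t^q is the identity, so pulling   *)
(* back along f does not change the action of Dist(U_r); on F_q it is zero, *)
(* so f^*N is trivial on U(F_q) for every U-module N.                       *)
(*                                                                          *)
(* Let X_i be the divided powers by which U acts on St_r, let v be a lowest *)
(* weight vector, of weight -(q-1), and x_i = X_i v, which vanishes for     *)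
(* i >= q. The factorization of y(s) u(t) through the big cell U T U^- gives*)
(*   y(s) sum_l t^l x_l = sum_l t^l (1 + s t)^(q-1-l) x_l,                  *)
(* so the span of the x_l is SL_2-stable, hence is St_r, and x_(q-1) is     *)
(* nonzero because y(s) x_(q-1) = sum_l s^(q-1-l) x_l involves x_0 = v.     *)
(* Since X_(q-1-i) X_i = C(q-1,i) X_(q-1) and C(q-1,i) = +-1 in k, a module *)
(* spanned by the X_i v (i < q) with X_(q-1) v <> 0 is free of rank one     *)
(* over Dist(U_r).                                                          *)
(*                                                                          *)
(* A nonzero trivial module is not projective over k U(F_q), as p divides   *)
(* |U(F_q)|.                                                                *)

(** Through [iso], a [U]-module is a family of divided powers [Ga_op i], and Dist(U_r) acts only
    through those with i < q. Since t - t^q agrees with t modulo t^q, pulling back leaves these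
    unchanged ([Ga_op_artin_schreier]), while a point over F_q has a coordinate with t^q = t and
    acts as the identity ([artin_schreier_trivial]).

    Projectivity over U_r thus reduces to finding a vector whose divided powers below q span and
    whose top one is nonzero: it freely generates the module ([Ur_projective]). In St_r a lowest
    weight vector will do ([steinberg_generator]), once conjugation in SL_2 has brought [iso] to the
    standard upper triangular form ([Ga_conj], [steinberg_restriction]).

    For the counterexample the same criterion is applied to the polynomials of degree less than q
    ([translation_projective]). Their pullback is nonzero and trivial over U(F_q), hence not
    projective ([Fq_trivial_not_projective]). *)

Lemma projective_free1 (R : pzRingType) (P : lmodType R) (v : P) :
  (forall w, exists a : R, w = a *: v) -> (forall a : R, a *: v = 0 -> a = 0) ->
  projective P.
Proof.
move=> gen_v free_v N N' g h g_surj.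
have [x gx] := g_surj (h v).
(* Freeness makes the coefficient [c w] unique, hence linear in [w]; the lift sends [v] to a chosen
   preimage [x] of [h v]. *)
have [c cE] := choice gen_v.
have cZ a w u : c (a *: w + u) = a * c w + c u.
  apply/eqP; rewrite -subr_eq0; apply/eqP/free_v.
  by rewrite scalerBl -cE scalerDl -scalerA -!cE subrr.
have lin : linear (fun w => c w *: x) by move=> a w u; rewrite cZ scalerDl scalerA.
pose h' : P -> N := fun w => c w *: x.
pose hL := GRing.isLinear.Build R P N *:%R h' lin.
pose H : {linear P -> N} := HB.pack h' hL.
by exists H => w; rewrite /= /h' linearZ gx -linearZ -cE.
Qed.

(** The coefficient is (-1)^i in k: by [bin_char0], C(q, i+1) vanishes in k for i+1 < q, so by
    Pascal's rule consecutive C(q-1, i) are opposite. *)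
Lemma bin_pred_pchar_neq0 (k : closedFieldType) (p r i : nat) :
  p \in [pchar k] -> (i < p ^ r)%N -> 'C((p ^ r).-1, i)%:R != 0 :> k.
Proof.
move=> charp lt_iq; set q := (p ^ r)%N in lt_iq *.
have -> : 'C(q.-1, i)%:R = (-1) ^+ i :> k; last by rewrite signr_eq0.
elim: i lt_iq => [|i IH] lt_iq; first by rewrite bin0.
have := bin_char0 charp lt_iq (_ : (q - i.+1 < q)%N).
rewrite subnKC ?(ltnW lt_iq) // leqnn => /(_ _ isT) binq0.
have: 'C(q, i.+1)%:R = 0 :> k by apply: binq0; lia.
have {1}-> : q = q.-1.+1 by lia.
rewrite binS natrD IH; last by lia.
by move/eqP; rewrite addr_eq0 => /eqP ->; rewrite exprS mulN1r.
Qed.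

Lemma Ur_projective (k : closedFieldType) (p : nat) (charp : p \in [pchar k])
    (U : closed_subgroup k) (iso : Ga_iso p U) (r : nat) (M : rational_module U)
    (v : 'cV[k]_(rm_dim M)) :
  Ga_op iso M (p ^ r).-1 *m v != 0 ->
  (forall w, exists a : nat -> k,
     w = \sum_(i < p ^ r) a i *: (Ga_op iso M i *m v)) ->
  projective (Ur_module charp iso r M : lmodType (dist_algebra k (p ^ r))).
Proof.
set q := (p ^ r)%N => top_v gen_v.
apply: (@projective_free1 _ (Ur_module charp iso r M) v) => [w|a].
  have [a ->] := gen_v w; exists ([ffun i : 'I_q => a i] : dist_algebra k q).
  by apply: eq_bigr => i _; rewrite ffunE.
move=> /= av0; apply/ffunP => i; rewrite [RHS]ffunE.
(* Apply Ga_op (q-1-i), where i is the least index not yet known to vanish. *)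
have [m] := ubnP i; elim: m i => // m IH i /ltnSE le_im.
have iq := ltn_ord i.
have: Ga_op iso M (q.-1 - i) *m (\sum_(j < q) a j *: (Ga_op iso M j *m v)) = 0.
  by rewrite [X in _ *m X]av0 mulmx0.
rewrite mulmx_sumr (bigD1 i) //= big1 ?addr0 => [|j ne_ji].
  rewrite -scalemxAr mulmxA Ga_op_mul subnK; last by lia.
  rewrite -scalemxAl => /eqP; rewrite !scaler_eq0 (negPf top_v) orbF.
  case/orP=> /eqP // /eqP; rewrite (negPf (bin_pred_pchar_neq0 charp _)) //.
  by rewrite -/q; lia.
case: (ltngtP j i) => [lt_ji|lt_ij|/val_inj E]; last by rewrite E eqxx in ne_ji.
  by rewrite IH ?scale0r ?mulmx0 //; lia.
(* For j > i the index (q-1-i) + j is at least q, so the binomial coefficient of the product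
   vanishes in k. *)
rewrite -scalemxAr mulmxA Ga_op_mul (bin_char0 charp (r := r)) ?scale0r ?mul0mx ?scaler0 //.
  by rewrite -/q in iq *; lia.
by rewrite -/q in iq *; move: iq lt_ij; clear; move: (nat_of_ord i) (nat_of_ord j) => x y; lia.
Qed.

(** * Pullback along t - t^q *)

(** The factor [R] allows for identities known only on a nonempty open set, such as the big cell;
    [R = 1] is the plain case. *)
Lemma poly_eq_horner (k : closedFieldType) (R P Q : {poly k}) :
  R != 0 -> (forall t, R.[t] != 0 -> P.[t] = Q.[t]) -> P = Q.
Proof.
move=> nzR E; apply/eqP; rewrite -subr_eq0.
have: R * (P - Q) == 0.
  apply/negPn/negP => /closed_nonrootP[t].
  rewrite rootM negb_or => /andP[Rt]; rewrite rootE hornerD hornerN.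
  by rewrite (E t Rt) subrr eqxx.
by rewrite mulf_eq0 (negPf nzR).
Qed.

(** Used for t - t^q and t, whose difference is - t^q: composing with t - t^q then changes no
    coefficient below q. *)
Lemma comp_poly_subX (R : comNzRingType) (P Q1 Q2 : {poly R}) :
  exists D, (P \Po Q1) - (P \Po Q2) = D * (Q1 - Q2).
Proof.
elim/poly_ind: P => [|P c [D E]]; first by exists 0; rewrite !comp_poly0 subrr mul0r.
exists (D * Q1 + (P \Po Q2)); rewrite !comp_polyD !comp_polyM !comp_polyX !comp_polyC.
have -> : P \Po Q1 = D * (Q1 - Q2) + (P \Po Q2) by rewrite -E subrK.
ring.
Qed.

Lemma coef_comp_artin_schreier (k : closedFieldType) (q i : nat) (P : {poly k}) :
  (i < q)%N -> (P \Po artin_schreier_poly k q)`_i = P`_i.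
Proof.
move=> lt_iq; have [D] := comp_poly_subX P (artin_schreier_poly k q) 'X.
rewrite comp_polyXr /artin_schreier_poly addrAC subrr add0r mulrN => E.
have := congr1 (fun Q : {poly k} => Q`_i) E.
by rewrite coefB coefN coefMXn lt_iq oppr0 => /eqP; rewrite subr_eq0 => /eqP.
Qed.

Lemma frobD (k : closedFieldType) (p r : nat) : p \in [pchar k] ->
  {morph @frob k (p ^ r) : x y / x + y}.
Proof. by move=> charp x y; rewrite /frob exprDn_pchar // pnat_q. Qed.

Lemma frob0 (k : closedFieldType) (p r : nat) : p \in [pchar k] ->
  frob (p ^ r) 0 = 0 :> k.
Proof.
move=> charp.
by rewrite /frob expr0n expn_eq0 eqn0Ngt prime_gt0 // (pcharf_prime charp).
Qed.

Lemma frob_Fp (k : closedFieldType) (p r : nat) (x : k) :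
  x \in Fq p -> frob (p ^ r) x = x.
Proof.
move=> /eqP E; rewrite /frob; elim: r => [|m IH]; first by rewrite expn0 expr1.
by rewrite expnS exprM E.
Qed.

Section ArtinSchreierPullback.
Variables (k : closedFieldType) (p : nat) (charp : p \in [pchar k]).
Variables (U : closed_subgroup k) (iso : Ga_iso p U) (r : nat).
Variable N : rational_module U.
Local Notation q := (p ^ r)%N.
Local Notation M := (pullback (artin_schreier charp iso r) N).

Lemma rm_act_artin_schreier g :
  rm_act M g =
  rm_act N (param_at (ga_param iso)
    (artin_schreier_poly k q).[mxeval g (ga_coord iso)]).
Proof. by rewrite /rm_act mateval_subst mateval_Ga_endo. Qed.

Lemma Ga_op_artin_schreier i : (i < q)%N -> Ga_op iso M i = Ga_op iso N i.
Proof.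
move=> lt_iq; apply/matrixP => a b; rewrite !mxE /coefp.
rewrite -(coef_comp_artin_schreier (mmap _ _ (rm_coef N a b)) lt_iq).
congr (nth 0 (polyseq _) i); apply: (@poly_eq_horner k 1) => [|t _]; first exact: oner_neq0.
have /matrixP/(_ a b) := Ga_coefE iso M t.
rewrite rm_act_artin_schreier ga_paramK -Ga_coefE.
by rewrite !mxE /horner_eval horner_comp.
Qed.

Lemma param_at0 : param_at (ga_param iso) 0 = 1%:M.
Proof.
have u0 : param_at (ga_param iso) 0 \in unitmx.
  by rewrite unitmxE (cs_det (ga_param_in iso 0)) unitr1.
apply: (can_inj (mulKmx u0)); rewrite mulmx1.
by rewrite -ga_param_add addr0.
Qed.

Lemma artin_schreier_trivial (r_gt0 : (0 < r)%N) (g : Fq_points charp r_gt0 U) :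
  rm_act M (val g) = 1%:M.
Proof.
rewrite rm_act_artin_schreier; set t := mxeval _ _.
(* The entries of [g] lie in F_q and the coordinate polynomial has coefficients in F_p, so raising
   to the q-th power fixes [t]. *)
suff tq : t ^+ q = t.
  by rewrite !hornerE tq subrr param_at0 /rm_act rm_one.
have /andP[_ /forallP gFq] := valP g.
rewrite -[LHS]/(frob q t) /t /mxeval mevalE (big_morph _ (frobD r charp) (frob0 r charp)).
rewrite !big_seq; apply: eq_bigr => m mc; rewrite /frob exprMn -prodrXl; congr (_ * _).
  apply: (frob_Fp r); have := ga_coord_Fp iso; rewrite qualifE => /allP.
  by apply; apply: map_f.
apply: eq_bigr => l _; rewrite -exprM mulnC exprM; congr (_ ^+ _).
case/mxvec_indexP: l => i j; rewrite mxvecE.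
by have /forallP/(_ j)/eqP := gFq i.
Qed.
End ArtinSchreierPullback.

(** * Trivial modules over the algebra of a finite group *)

Section TrivialModules.
Variables (k : fieldType) (G : finGroupType).
Local Notation kG := (group_algebra k G).

Definition galg_delta (g : G) : kG := [ffun x : G => (x == g)%:R].

Lemma galg_deltaM g (a : kG) x : (galg_delta g * a) x = a (g^-1 * x)%g.
Proof.
rewrite ffunE (bigD1 g) //= big1 => [|y ne_yg]; first by rewrite ffunE eqxx mul1r addr0.
by rewrite ffunE (negPf ne_yg) mul0r.
Qed.

Lemma galg_sumE (I : finType) (F : I -> kG) x : (\sum_i F i) x = \sum_i F i x.
Proof. exact: sum_ffunE. Qed.

Lemma galg_norm : \sum_g galg_delta g = [ffun=> 1].
Proof.
apply/ffunP => x; rewrite galg_sumE (bigD1 x) //= big1 => [|y ne_yx].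
  by rewrite !ffunE eqxx addr0.
by rewrite ffunE eq_sym (negPf ne_yx).
Qed.

Lemma galg_const (c : k) :
  ([ffun=> c] : kG) = ([ffun x : G => c * (x == 1%g)%:R] : kG) * \sum_g galg_delta g.
Proof.
rewrite galg_norm; apply/ffunP => x.
rewrite [LHS]ffunE [RHS]ffunE (bigD1 1%g) //= big1 => [|y ne_y1].
  by rewrite !ffunE eqxx addr0 !mulr1.
by rewrite ffunE (negPf ne_y1) mulr0 mul0r.
Qed.

(* A lift of the identity along a free cover would have values in the       *)
(* G-invariants of the cover, which are multiples of the norm element; the  *)
(* norm element kills V.                                                    *)
Lemma trivial_projective_eq0 (V : lmodType kG) (n : nat) (e : 'I_n -> V) :
  #|G|%:R = 0 :> k ->
  (forall g (v : V), galg_delta g *: v = v) ->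
  (forall v, exists a : {ffun 'I_n -> kG^o}, v = \sum_i a i *: e i) ->
  projective V -> forall v : V, v = 0.
Proof.
move=> G0 trivV gen_e projV.
pose f (a : {ffun 'I_n -> kG^o}) : V := \sum_i a i *: e i.
have f_lin : linear f.
  move=> c a b; rewrite /f scaler_sumr -big_split; apply: eq_bigr => i _.
  by rewrite !ffunE scalerDl scalerA.
pose fL := GRing.isLinear.Build kG {ffun 'I_n -> kG^o} V *:%R f f_lin.
pose F : {linear {ffun 'I_n -> kG^o} -> V} := HB.pack f fL.
have [|h hE] := projV _ _ F (idfun : {linear V -> V}).
  by move=> v; have [a ->] := gen_e v; exists a.
move=> v; rewrite -[v]hE /= /f big1 // => i _.
have -> : h v i = [ffun=> h v i 1%g].
  apply/ffunP => x; rewrite ffunE -[in LHS](trivV x v) linearZ.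
  by rewrite ffunE [LHS]galg_deltaM mulVg.
rewrite galg_const -scalerA scaler_suml (eq_bigr (fun=> e i)) => [|g _].
  have -> : \sum_(g : G) e i = (#|G|%:R : kG) *: e i.
    by rewrite scaler_nat sumr_const.
  have -> : #|G|%:R = 0 :> kG.
    apply/ffunP => x; rewrite -sumr_const galg_sumE sumr_const -[LHS]mulr_natr.
    by rewrite G0 mulr0 ffunE.
  by rewrite scale0r scaler0.
exact: trivV.
Qed.
End TrivialModules.

Section FiniteSubgroup.
Variables (k : closedFieldType) (p : nat) (charp : p \in [pchar k]).
Variables (r : nat) (r_gt0 : (0 < r)%N).
Variables (U : closed_subgroup k) (iso : Ga_iso p U).
Local Notation G := (Fq_points charp r_gt0 U).

Let param1P : `[< U (param_at (ga_param iso) 1) >] &&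
  [forall i, forall j, param_at (ga_param iso) 1 i j \in Fq (p ^ r)].
Proof.
apply/andP; split; first by apply/asboolP/ga_param_in.
apply/forallP => i; apply/forallP => j; rewrite inE mxE /horner_eval.
rewrite -[_ ^+ _]/(frob _ _) horner_coef (big_morph _ (frobD r charp) (frob0 r charp)).
apply/eqP; apply: eq_bigr => l _; rewrite expr1n mulr1; apply: frob_Fp.
have := ga_param_Fp iso i j; rewrite qualifE => /allP; apply; exact: mem_nth.
Qed.

(** The point of coordinate 1 is rational because [iso] is defined over F_p, and it has order p;
    Lagrange's theorem concludes. *)
Lemma card_Fq_points_pchar : #|(G : finGroupType)|%:R = 0 :> k.
Proof.
have pr_p := pcharf_prime charp.
pose g : G := Sub (param_at (ga_param iso) 1) param1P.
have gX m : val (g ^+ m)%g = param_at (ga_param iso) m%:R.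
  elim: m => [|m IH]; first by rewrite expg0 (param_at0 iso).
  by rewrite expgS mulrS ga_param_add -IH.
have gp : (g ^+ p = 1)%g.
  by apply: val_inj; rewrite gX (pcharf0 charp) (param_at0 iso).
have og : #[g]%g = p.
  apply: nt_prime_order => //; apply/eqP => /(congr1 val)/=.
  rewrite -(param_at0 iso) => /(congr1 (fun A => mxeval A (ga_coord iso))).
  by rewrite !ga_paramK => /eqP; rewrite oner_eq0.
have := order_dvdG (in_setT g); rewrite og cardsT => /dvdnP[m ->].
by rewrite natrM (pcharf0 charp) mulr0.
Qed.

Lemma Fq_trivial_not_projective (M : rational_module U) : (0 < rm_dim M)%N ->
  (forall g : G, rm_act M (val g) = 1%:M) ->
  ~ projective (Fq_module charp r_gt0 M : lmodType (group_algebra k G)).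
Proof.
move=> n_gt0 trivM projM.
pose e (i : 'I_(rm_dim M)) : Fq_module charp r_gt0 M := delta_mx i 0.
have scaleE (a : group_algebra k G) (v : Fq_module charp r_gt0 M) :
    a *: v = (\sum_g a g) *: (v : 'cV[k]_(rm_dim M)).
  rewrite scaler_suml; apply: eq_bigr => g _.
  by rewrite trivM mul1mx.
have triv_delta (g : G) (v : Fq_module charp r_gt0 M) : galg_delta k g *: v = v.
  rewrite scaleE (bigD1 g) //= big1 => [|h ne_hg].
    by rewrite ffunE eqxx addr0 scale1r.
  by rewrite ffunE (negPf ne_hg).
have gen_e (v : Fq_module charp r_gt0 M) :
    exists a : {ffun 'I_(rm_dim M) -> (group_algebra k G)^o}, v = \sum_i a i *: e i.
  pose w : 'cV[k]_(rm_dim M) := v.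
  pose a i : (group_algebra k G)^o := [ffun x : G => (x == 1%g)%:R * w i 0].
  exists [ffun i => a i]; rewrite -[LHS]/w [LHS]matrix_sum_delta.
  apply: eq_bigr => i _; rewrite big_ord1 ffunE scaleE.
  suff -> : \sum_g a i g = w i 0 by [].
  rewrite (bigD1 1%g) //= big1 => [|g ne_g1]; first by rewrite ffunE eqxx mul1r addr0.
  by rewrite ffunE (negPf ne_g1) mul0r.
have /matrixP/(_ (Ordinal n_gt0) 0) := trivial_projective_eq0
  card_Fq_points_pchar triv_delta gen_e projM (const_mx 1).
by rewrite !mxE => /eqP; rewrite oner_eq0.
Qed.
End FiniteSubgroup.

(** * The translation module *)

Lemma coef_addX_exp (R : comNzRingType) (t : R) (i j : nat) :
  (('X + t%:P) ^+ j)`_i = 'C(j, i)%:R * t ^+ (j - i).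
Proof.
rewrite addrC exprDn coef_sum.
under eq_bigr => l _ do rewrite coefMn -rmorphXn coefCM coefXn.
rewrite -(sum_pick (q := j.+1) (s := i) (F := fun l => 'C(j, l)%:R * t ^+ (j - l))).
  apply: eq_bigr => l _; case: eqP => _; last by rewrite mulr0 mul0rn.
  by rewrite mulr1 mulr_natl.
by move=> lt_ji; rewrite bin_small ?mul0r.
Qed.

Section TranslationModule.
Variables (k : closedFieldType) (p : nat) (U : closed_subgroup k).
Variables (iso : Ga_iso p U) (q : nat).

Lemma ga_coord1 : mxeval 1%:M (ga_coord iso) = 0.
Proof. by rewrite -(param_at0 iso) ga_paramK. Qed.

Lemma ga_coordM g h : U g -> U h ->
  mxeval (g *m h) (ga_coord iso) = mxeval g (ga_coord iso) + mxeval h (ga_coord iso).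
Proof.
move=> Ug Uh; rewrite -{1}(ga_coordK iso Ug) -{1}(ga_coordK iso Uh).
by rewrite -ga_param_add ga_paramK.
Qed.

(** Column j lists the coefficients of (X + t)^j; where j < i the truncated exponent is harmless, as
    the binomial is 0. *)
Definition translation_coef : 'M[{mpoly k[(2 * 2)%N]}]_q :=
  \matrix_(i, j) ('C(j, i)%:R *: ga_coord iso ^+ (j - i)).

Lemma mateval_translation g : mateval translation_coef g =
  \matrix_(i, j) (('X + (mxeval g (ga_coord iso))%:P) ^+ j)`_i.
Proof.
apply/matrixP => i j; rewrite !mxE coef_addX_exp.
by rewrite /mxeval mevalZ rmorphXn.
Qed.

Fact translation_one : mateval translation_coef 1%:M = 1%:M.
Proof.
rewrite mateval_translation ga_coord1; apply/matrixP => i j.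
by rewrite !mxE addr0 coefXn.
Qed.

Fact translation_mul g h : U g -> U h ->
  mateval translation_coef (g *m h) =
  mateval translation_coef g *m mateval translation_coef h.
Proof.
move=> Ug Uh; rewrite !mateval_translation ga_coordM //.
move: (mxeval g _) (mxeval h _) => s t; apply/matrixP => i j; rewrite !mxE.
have -> : 'X + (s + t)%:P = ('X + t%:P) \Po ('X + s%:P).
  by rewrite comp_polyD comp_polyX comp_polyC polyCD addrA.
rewrite -rmorphXn coef_comp_poly.
rewrite (big_ord_widen q (fun l => (('X + t%:P) ^+ j)`_l * (('X + s%:P) ^+ l)`_i)).
  rewrite big_mkcond; apply: eq_bigr => l _; rewrite !mxE mulrC.
  by case: ltnP => // le_sl; rewrite (nth_default _ le_sl) ?mulr0 ?mul0r.
by rewrite -[t]opprK polyCN size_exp_XsubC.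
Qed.

(* The polynomials of degree less than q in k[G_a], in the monomial basis,  *)
(* G_a acting by translation. As a U-module it is a copy of St_r; using it  *)
(* spares the construction of a simple SL_2-module of highest weight q-1.   *)
Definition translation_module : rational_module U :=
  RationalModule translation_one translation_mul.

(** These are the Hasse derivatives, X^j being sent to C(j, l) X^(j-l). *)
Lemma Ga_op_translation (l : nat) :
  Ga_op iso translation_module l =
  \matrix_(i, j) ('C(j, i) * (j == (i + l)%N :> nat))%:R.
Proof.
apply/matrixP => i j; rewrite !mxE /coefp.
transitivity (('C(j, i)%:R *: 'X^(j - i) : {poly k})`_l).
  congr (nth 0 (polyseq _) l).
  apply: (@poly_eq_horner k 1) => [|t _]; first exact: oner_neq0.
  have /matrixP/(_ i j) := Ga_coefE iso translation_module t.
  rewrite /rm_act mateval_translation ga_paramK !mxE /horner_eval => ->.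
  by rewrite coef_addX_exp !hornerE.
rewrite coefZ coefXn natrM; case: (leqP i j) => [le_ij|lt_ji].
  by congr (_ * _%:R); lia.
by rewrite bin_small ?mul0r.
Qed.
End TranslationModule.

Lemma Ur_projective_artin_schreier (k : closedFieldType) (p : nat)
    (charp : p \in [pchar k]) (U : closed_subgroup k) (iso : Ga_iso p U) (r : nat)
    (N : rational_module U) (v : 'cV[k]_(rm_dim N)) :
  Ga_op iso N (p ^ r).-1 *m v != 0 ->
  (forall w, exists a : nat -> k,
     w = \sum_(i < p ^ r) a i *: (Ga_op iso N i *m v)) ->
  projective (Ur_module charp iso r (pullback (artin_schreier charp iso r) N) :
    lmodType (dist_algebra k (p ^ r))).
Proof.
set q := (p ^ r)%N => top_v gen_v.
have q_gt0 : (0 < q)%N by rewrite expn_gt0 prime_gt0 // (pcharf_prime charp).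
apply: (@Ur_projective _ _ charp _ iso r (pullback _ N) v) => [|w].
  by rewrite Ga_op_artin_schreier // -/q ltn_predL.
have [a ->] := gen_v w; exists a; apply: eq_bigr => i _.
by rewrite Ga_op_artin_schreier.
Qed.

(** The generator is X^(q-1): its Hasse derivatives are the multiples C(q-1, l) X^(q-1-l) of the
    monomials, with nonzero coefficients in k. *)
Lemma translation_projective (k : closedFieldType) (p : nat)
    (charp : p \in [pchar k]) (U : closed_subgroup k) (iso : Ga_iso p U) (r : nat) :
  projective (Ur_module charp iso r
    (pullback (artin_schreier charp iso r) (translation_module iso (p ^ r))) :
    lmodType (dist_algebra k (p ^ r))).
Proof.
set q := (p ^ r)%N.
have q_gt0 : (0 < q)%N by rewrite expn_gt0 prime_gt0 // (pcharf_prime charp).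
have lt_q : (q.-1 < q)%N by rewrite ltn_predL.
pose v : 'cV[k]_q := delta_mx (Ordinal lt_q) 0.
have opE l (i : 'I_q) : (Ga_op iso (translation_module iso q) l *m v) i 0 =
    ('C(q.-1, i) * (q.-1 == i + l)%N)%:R.
  by rewrite Ga_op_translation /v -colE !mxE.
apply: (@Ur_projective_artin_schreier _ _ charp _ iso r (translation_module iso q) v) => [|w].
  apply/eqP => /matrixP/(_ (Ordinal q_gt0) 0).
  by rewrite opE mxE bin0 add0n eqxx => /eqP; rewrite oner_eq0.
(* The coordinate of [w] at q-1-l; the reduction modulo q only makes [c] total on nat. *)
pose c (l : nat) := (w : 'cV[k]_q) (rev_ord (Ordinal (ltn_pmod l q_gt0))) 0.
exists (fun l => c l / 'C(q.-1, q.-1 - l)%:R).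
suff E (i : 'I_q) : (w : 'cV[k]_q) i 0 = (\sum_(l < q) (c l / 'C(q.-1, q.-1 - l)%:R) *:
    (Ga_op iso (translation_module iso q) l *m v)) i 0.
  by apply/matrixP => i j; rewrite [j]ord1; apply: E.
rewrite summxE.
rewrite (bigD1 (rev_ord i)) //= big1 => [|l ne_l]; last first.
  rewrite mxE opE; case: eqP => [E|_]; last by rewrite muln0 mulr0.
  by case/eqP: ne_l; apply: val_inj; rewrite /=; lia.
have iq := ltn_ord i.
rewrite addr0 mxE opE (_ : q.-1 - (q - i.+1) = i)%N; last by lia.
rewrite (_ : q.-1 == (i + (q - i.+1)))%N ?muln1; last by apply/eqP; lia.
rewrite mulfVK ?bin_pred_pchar_neq0 // /c; congr (w _ 0).
by apply: val_inj; rewrite /= modn_small; lia.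
Qed.

(** * Unipotent elements of SL_2 and conjugation of U *)

Definition mx2 (R : Type) (a b c d : R) : 'M[R]_2 :=
  \matrix_(i, j) if i == ord0 then (if j == ord0 then a else b)
                 else (if j == ord0 then c else d).

Lemma mx2_ext (R : Type) (A B : 'M[R]_2) :
  A ord0 ord0 = B ord0 ord0 -> A ord0 ord_max = B ord0 ord_max ->
  A ord_max ord0 = B ord_max ord0 -> A ord_max ord_max = B ord_max ord_max -> A = B.
Proof.
have ord2P (i : 'I_2) : i = ord0 \/ i = ord_max.
  by case: i => [[|[|[]]]] // lt_i; [left | right]; apply: val_inj.
move=> E1 E2 E3 E4; apply/matrixP => i j.
by case: (ord2P i) => ->; case: (ord2P j) => ->.
Qed.

Lemma mx2E (R : Type) (A : 'M[R]_2) :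
  A = mx2 (A ord0 ord0) (A ord0 ord_max) (A ord_max ord0) (A ord_max ord_max).
Proof. by apply: mx2_ext; rewrite !mxE. Qed.

Lemma mx2_inj (R : Type) (a b c d a' b' c' d' : R) :
  mx2 a b c d = mx2 a' b' c' d' -> [/\ a = a', b = b', c = c' & d = d'].
Proof.
move=> /matrixP E; have := (E ord0 ord0, E ord0 ord_max, E ord_max ord0, E ord_max ord_max).
by rewrite !mxE /= => -[[[-> ->] ->] ->].
Qed.

Lemma map_mx2 (R S : Type) (f : R -> S) a b c d :
  map_mx f (mx2 a b c d) = mx2 (f a) (f b) (f c) (f d).
Proof. by apply: mx2_ext; rewrite !mxE. Qed.

Lemma mx2_1 (R : pzSemiRingType) : 1%:M = mx2 1 0 0 1 :> 'M[R]_2.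
Proof. by apply: mx2_ext; rewrite !mxE. Qed.

Lemma mx2D (R : nmodType) (a b c d a' b' c' d' : R) :
  mx2 a b c d + mx2 a' b' c' d' = mx2 (a + a') (b + b') (c + c') (d + d').
Proof. by apply: mx2_ext; rewrite !mxE. Qed.

Lemma mx2N (R : zmodType) (a b c d : R) :
  - mx2 a b c d = mx2 (- a) (- b) (- c) (- d).
Proof. by apply: mx2_ext; rewrite !mxE. Qed.

Lemma mx2M (R : pzSemiRingType) (a b c d a' b' c' d' : R) :
  mx2 a b c d *m mx2 a' b' c' d' =
  mx2 (a * a' + b * c') (a * b' + b * d') (c * a' + d * c') (c * b' + d * d').
Proof. by apply: mx2_ext; rewrite !mxE !big_ord_recl big_ord0 !mxE /= addr0. Qed.

Lemma det_mx2 (R : comPzRingType) (a b c d : R) :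
  \det (mx2 a b c d) = a * d - b * c.
Proof.
rewrite (expand_det_row _ ord0) !big_ord_recl big_ord0 /cofactor !det_mx11 !mxE /=.
by ring.
Qed.

(** Nilpotency gives det (g - 1) = 0, which together with det g = 1 forces trace 2; so g - 1 has
    trace and determinant 0. *)
Lemma unipotent_mx2 (k : fieldType) (g : 'M[k]_2) n :
  \det g = 1 -> (g - 1%:M) ^+ n = 0 ->
  exists a b c, g = mx2 (1 + a) b c (1 - a) /\ a ^+ 2 + b * c = 0.
Proof.
move=> dg gn0; have dN : \det (g - 1%:M) = 0.
  have : \det (g - 1%:M) ^+ n = 0.
    rewrite -(det0 k 1) -gn0; elim: n {gn0} => [|n IH]; first by rewrite !expr0 det1.
    by rewrite !exprS det_mulmx IH.
  by move/eqP; rewrite expf_eq0 => /andP[_ /eqP].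
move: dg dN; rewrite (mx2E g) mx2_1 mx2N mx2D !det_mx2.
move: (g ord0 ord0) (g ord0 ord_max) (g ord_max ord0) (g ord_max ord_max).
move=> a b c d dg dN; exists (a - 1), b, c.
have dE : d = 1 - (a - 1).
  apply/eqP; rewrite -subr_eq0; apply/eqP.
  have -> : d - (1 - (a - 1)) =
    a * d - b * c - 1 - ((a - 1) * (d - 1) - (b - 0) * (c - 0)) by ring.
  by rewrite dg dN !subrr.
by rewrite -dE addrC subrK; split=> //; rewrite -[RHS]oppr0 -dN dE; ring.
Qed.

Lemma unipotent_conj (k : fieldType) (a b c : k) :
  a ^+ 2 + b * c = 0 -> mx2 (1 + a) b c (1 - a) != 1%:M ->
  exists h h' e, [/\ \det h = 1, h *m h' = 1%:M, h' *m h = 1%:M, e != 0 &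
    h *m mx2 (1 + a) b c (1 - a) *m h' = mx2 1 e 0 1].
Proof.
move=> E ne1; have [c0|nz_c] := eqVneq c 0; last first.
  (* The first column (a, c) of the inverse spans the image of g - 1, the line fixed by g; the
     second is scaled to give determinant 1. *)
  have hV : mx2 0 c^-1 (- c) a *m mx2 a (- c^-1) c 0 = 1%:M.
    by rewrite mx2M mx2_1; congr mx2; field.
  exists (mx2 0 c^-1 (- c) a), (mx2 a (- c^-1) c 0), (- c^-1).
  rewrite hV (mulmx1C hV) oppr_eq0 invr_eq0 nz_c; split=> //.
    by rewrite det_mx2; field.
  have -> : b = - a ^+ 2 / c.
    by apply: (mulIf nz_c); rewrite mulfVK //; apply/eqP; rewrite -subr_eq0 opprK addrC E.
  by rewrite !mx2M; congr mx2; field.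
have a0 : a = 0 by move/eqP: E; rewrite c0 mulr0 addr0 expf_eq0 => /eqP.
exists 1%:M, 1%:M, b; rewrite !mulmx1 mul1mx det1 a0 c0 addr0 subr0; split=> //.
by apply: contra ne1 => /eqP b0; rewrite a0 c0 b0 addr0 subr0 mx2_1.
Qed.

Lemma mxeval_param (k : closedFieldType) (A : 'M[{poly k}]_2) (P : {mpoly k[(2 * 2)%N]}) :
  exists Q : {poly k}, forall x, mxeval (param_at A x) P = Q.[x].
Proof.
exists (mmap (@polyC k) (fun i => mxvec A 0 i) P) => x; rewrite /mxeval.
elim/mpolyind: P => [|c m P _ _ IH]; first by rewrite !raddf0 horner0.
rewrite !raddfD /= hornerD IH; congr (_ + _).
rewrite mmapZ mevalZ mmapX mevalX hornerM hornerC; congr (_ * _).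
rewrite /mmap1 horner_prod; apply: eq_bigr => i _.
by rewrite horner_exp /param_at -map_mxvec mxE.
Qed.

Lemma param_atM (k : closedFieldType) (A B : 'M[{poly k}]_2) x :
  param_at (A *m B) x = param_at A x *m param_at B x.
Proof. exact: map_mxM. Qed.

Lemma param_atC (k : closedFieldType) (A : 'M[k]_2) x :
  param_at (map_mx polyC A) x = A.
Proof. by apply/matrixP => i j; rewrite !mxE /horner_eval hornerC. Qed.

(* The conjugated parametrization is t |-> u(b(t)) with b a polynomial. As  *)
(* the coordinate of the isomorphism inverts b polynomially, deg b = 1.     *)
Lemma Ga_conj (k : closedFieldType) (p : nat) (U : closed_subgroup k)
    (iso : Ga_iso p U) : unipotent U ->
  exists h h' e, [/\ \det h = 1, h *m h' = 1%:M, h' *m h = 1%:M, e != 0 &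
    forall t, h *m param_at (ga_param iso) t *m h' = mx2 1 (e * t) 0 1].
Proof.
move=> uniU; set u := param_at (ga_param iso).
have detu t : \det (u t) = 1 by apply/cs_det/ga_param_in.
have nilu t : exists n, (u t - 1%:M) ^+ n = 0 by apply/uniU/ga_param_in.
have ne_u1 : u 1 != 1%:M.
  apply/eqP => /(congr1 (fun A => mxeval A (ga_coord iso))).
  by rewrite ga_paramK ga_coord1 => /eqP; rewrite oner_eq0.
have [h [h' [e [deth hh' h'h nz_e u1E]]]] : exists h h' e,
    [/\ \det h = 1, h *m h' = 1%:M, h' *m h = 1%:M, e != 0 &
      h *m u 1 *m h' = mx2 1 e 0 1].
  have [n un] := nilu 1; have [a [b [c [uE abc]]]] := unipotent_mx2 (detu 1) un.
  by rewrite uE; apply: unipotent_conj; rewrite -?uE.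
pose b : {poly k} := (map_mx polyC h *m ga_param iso *m map_mx polyC h') ord0 ord_max.
have conjuE t : h *m u t *m h' = mx2 1 b.[t] 0 1.
  have bE : b.[t] = (h *m u t *m h') ord0 ord_max.
    rewrite -[in RHS](param_atC h t) -[in RHS](param_atC h' t) -!param_atM.
    by rewrite mxE.
  have [n un] := nilu t.
  have dP : \det (h *m u t *m h') = 1.
    by rewrite !det_mulmx mulrAC -det_mulmx hh' det1 mul1r.
  have P1 : h *m u t *m h' - 1%:M = h *m (u t - 1%:M) *m h'.
    by rewrite mulmxBr mulmxBl mulmx1 hh'.
  have nilP m : (h *m u t *m h' - 1%:M) ^+ m = h *m (u t - 1%:M) ^+ m *m h'.
    rewrite P1; elim: m => [|m IH]; first by rewrite !expr0 mulmx1 hh'.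
    rewrite !exprS IH -!mulmxE !mulmxA; congr (_ *m _ *m _).
    by rewrite -(mulmxA _ h' h) h'h mulmx1.
  have := nilP n; rewrite un mulmx0 mul0mx => Pn0.
  have [x [y [z [PE xyz]]]] := unipotent_mx2 dP Pn0.
  (* Commuting with [mx2 1 e 0 1], where e is nonzero, forces the lower left entry to be 0;
     nilpotency then makes the diagonal 1. *)
  have comm : (h *m u t *m h') *m (h *m u 1 *m h') = (h *m u 1 *m h') *m (h *m u t *m h').
    rewrite !mulmxA -(mulmxA _ h' h) h'h mulmx1 -(mulmxA _ h' h) h'h mulmx1.
    by congr (_ *m _); rewrite -!mulmxA -!ga_param_add addrC.
  rewrite bE; move: comm; rewrite u1E PE !mx2M => comm; have [E _ _ _] := mx2_inj comm.
  have z0 : z = 0.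
    apply/(mulfI nz_e)/(addrI (1 * (1 + x))); rewrite -E; ring.
  have x0 : x = 0 by move/eqP: xyz; rewrite z0 mulr0 addr0 expf_eq0 => /eqP.
  by rewrite mxE /= x0 z0 addr0 subr0.
have [Q QE] := mxeval_param (map_mx polyC h' *m mx2 1 'X 0 1 *m map_mx polyC h) (ga_coord iso).
have Qb : Q \Po b = 'X.
  apply: (@poly_eq_horner k 1) => [|t _]; first exact: oner_neq0.
  rewrite horner_comp -QE !param_atM !param_atC hornerX /param_at map_mx2.
  rewrite /horner_eval hornerX !hornerC -conjuE !mulmxA h'h mul1mx.
  by rewrite -mulmxA h'h mulmx1 ga_paramK.
have sb : size b = 2.
  have := size_comp_poly Q b; rewrite Qb size_polyX => /esym/eqP.
  by rewrite muln_eq1 => /andP[_ /eqP]; case: (size b) => // n /= ->.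
have b0 : b`_0 = 0.
  have := conjuE 0; rewrite /u (param_at0 iso) mulmx1 hh' mx2_1 => E.
  by rewrite -horner_coef0; have [_ <- _ _] := mx2_inj E.
exists h, h', b`_1; split=> // [|t].
  by have := lead_coef_eq0 b; rewrite /lead_coef sb => ->; rewrite -size_poly_eq0 sb.
by rewrite conjuE horner_coef sb !big_ord_recl big_ord0 /= b0 mul0r add0r addr0.
Qed.

(** * Divided powers on the Steinberg module *)

(** Turns an identity between generating functions in t, valid off the zeros of [R], into identities
    for the single divided powers. *)
Lemma coef_matrix_eq (k : closedFieldType) (m n N : nat) (x : nat -> 'M[k]_(m, n))
    (I : finType) (P : I -> {poly k}) (b : I -> 'M[k]_(m, n)) (R : {poly k}) :
  R != 0 ->
  (forall t, R.[t] != 0 ->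
     \sum_(i < N) t ^+ i *: x i = \sum_l (P l).[t] *: b l) ->
  forall i, (i < N)%N -> x i = \sum_l (P l)`_i *: b l.
Proof.
move=> nzR E i lt_iN; apply/matrixP => a c.
have PE : \poly_(j < N) x j a c = \sum_l b l a c *: P l.
  apply: (poly_eq_horner nzR) => t /E/matrixP/(_ a c).
  rewrite !summxE horner_poly horner_sum => Et.
  transitivity (\sum_(j < N) (t ^+ j *: x j) a c).
    by apply: eq_bigr => j _; rewrite mxE mulrC.
  by rewrite Et; apply: eq_bigr => l _; rewrite hornerZ mxE mulrC.
have := congr1 (coefp i) PE; rewrite /coefp coef_poly lt_iN coef_sum => ->.
by rewrite summxE; apply: eq_bigr => l _; rewrite coefZ mxE mulrC.
Qed.

Section SteinbergRestriction.
Variables (k : closedFieldType) (q : nat) (q_gt0 : (0 < q)%N).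
Variables (St : rational_module (@SL2 k)).
Local Notation n := (rm_dim St).
Local Notation rho := (rm_act St).
Local Notation u t := (mx2 1 t 0 1 : 'M[k]_2).
Local Notation y t := (mx2 1 0 t 1 : 'M[k]_2).
Local Notation w := (mx2 0 1 (-1) 0 : 'M[k]_2).

Variable Z : 'M[{poly k}]_n.
Hypothesis rho_u : forall t, rho (u t) = map_mx (horner_eval t) Z.
Local Notation X i := (map_mx (coefp i) Z : 'M[k]_n).

Lemma SL2_actM g h : \det g = 1 -> \det h = 1 -> rho (g *m h) = rho g *m rho h.
Proof. exact: (@rm_mul k SL2 St). Qed.

Lemma SL2_act1 : rho 1%:M = 1%:M.
Proof. exact: rm_one. Qed.

Lemma torus_mx2 (a : k) : torus a = mx2 a 0 0 a^-1.
Proof. by apply: mx2_ext; rewrite !mxE /= ?mulr1n ?mulr0n. Qed.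

Lemma det_mx2_upper (t : k) : \det (u t) = 1. Proof. by rewrite det_mx2; ring. Qed.
Lemma det_mx2_lower (t : k) : \det (y t) = 1. Proof. by rewrite det_mx2; ring. Qed.
Lemma det_mx2_weyl : \det w = 1. Proof. by rewrite det_mx2; ring. Qed.
Lemma det_torus (a : k) : a != 0 -> \det (torus a) = 1.
Proof. by move=> nz_a; rewrite torus_mx2 det_mx2; field. Qed.

Lemma SL2_X0 : X 0 = 1%:M.
Proof.
rewrite -SL2_act1 mx2_1 rho_u; apply/matrixP => i j.
by rewrite !mxE /horner_eval horner_coef0.
Qed.

Lemma rho_u_expansion : exists N, forall m, (N <= m)%N ->
  X m = 0 /\ forall t (v : 'cV[k]_n), rho (u t) *m v = \sum_(i < m) t ^+ i *: (X i *m v).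
Proof.
pose N := \max_i \max_j size (Z i j).
have sZ i j : (size (Z i j) <= N)%N.
  by apply: leq_trans (leq_bigmax i); apply: leq_bigmax j.
exists N => m le_Nm; split.
  by apply/matrixP => i j; rewrite !mxE /coefp nth_default // (leq_trans (sZ i j)).
move=> t v; rewrite rho_u.
under eq_bigr => i _ do rewrite scalemxAl.
rewrite -mulmx_suml; congr (_ *m _); apply/matrixP => i j.
rewrite mxE summxE /horner_eval (horner_coef_wide _ (leq_trans (sZ i j) le_Nm)).
by apply: eq_bigr => l _; rewrite !mxE mulrC.
Qed.

Definition weight_vector (m : int) (v : 'cV[k]_n) :=
  forall a : k, a != 0 -> rho (torus a) *m v = (a ^ m) *: v.

(** Compare coefficients of t in torus(a) u(t) = u(a^2 t) torus(a). *)
Lemma weight_vector_X m (v : 'cV[k]_n) i :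
  weight_vector m v -> weight_vector (m + i%:Z *+ 2) (X i *m v).
Proof.
move=> wv a nz_a; have [N expN] := rho_u_expansion.
have [lt_iN|/expN[-> _]] := ltnP i N; last by rewrite mul0mx mulmx0 scaler0.
have /expN[_ {}expN] := leqnn N.
pose P (l : 'I_N) : {poly k} := (a ^ m * a ^+ (2 * l)) *: 'X^l.
have E : forall t, (1 : {poly k}).[t] != 0 ->
    \sum_(j < N) t ^+ j *: (rho (torus a) *m (X j *m v)) = \sum_l (P l).[t] *: (X l *m v).
  move=> t _; transitivity (rho (torus a) *m (rho (u t) *m v)).
    by rewrite expN mulmx_sumr; apply: eq_bigr => j _; rewrite -scalemxAr.
  have -> : rho (torus a) *m (rho (u t) *m v) = rho (u (a ^+ 2 * t)) *m (rho (torus a) *m v).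
    rewrite !mulmxA -!SL2_actM ?det_torus ?det_mx2_upper //; congr (rho _ *m _).
    by rewrite torus_mx2 !mx2M; congr mx2; field.
  rewrite wv // -scalemxAr expN scaler_sumr; apply: eq_bigr => l _.
  by rewrite scalerA /P hornerZ hornerXn exprMn exprM mulrA.
have -> := coef_matrix_eq (x := fun j => rho (torus a) *m (X j *m v)) (oner_neq0 _) E lt_iN.
rewrite (bigD1 (Ordinal lt_iN)) //= big1 => [|l ne_l].
  rewrite addr0 coefZ coefXn eqxx mulr1 expfzDr //.
  by rewrite (_ : i%:Z *+ 2 = (2 * i)%N%:Z) //; lia.
rewrite coefZ coefXn; case: eqP => [E'|_]; last by rewrite mulr0 scale0r.
by case/eqP: ne_l; apply: val_inj; rewrite /= E'.
Qed.

(** A matrix of SL_2 with c != 0 is a product u y u; if c = 0, splitting off the right factor y(-1)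
    leaves a matrix with lower left entry d != 0. *)
Lemma SL2_stable (P : 'cV[k]_n -> Prop) :
  (forall t v, P v -> P (rho (u t) *m v)) -> (forall t v, P v -> P (rho (y t) *m v)) ->
  forall g v, \det g = 1 -> P v -> P (rho g *m v).
Proof.
move=> Pu Py.
have gen a b c d v : a * d - b * c = 1 -> c != 0 -> P v -> P (rho (mx2 a b c d) *m v).
  move=> det1 nz_c Pv.
  have -> : mx2 a b c d = u ((a - 1) / c) *m (y c *m u ((d - 1) / c)).
    have -> : b = (a * d - 1) / c.
      by apply: (mulIf nz_c); rewrite mulfVK // -det1; ring.
    by rewrite !mx2M; congr mx2; field.
  rewrite !SL2_actM ?det_mulmx ?det_mx2_upper ?det_mx2_lower ?mulr1 // -!mulmxA.
  by apply/Pu/Py/Pu.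
move=> g v; rewrite (mx2E g) det_mx2.
move: (g ord0 ord0) (g ord0 ord_max) (g ord_max ord0) (g ord_max ord_max).
move=> a b c d det1 Pv.
have [c0|nz_c] := eqVneq c 0; last exact: gen.
have nz_d : d != 0.
  apply/eqP => d0; move: det1; rewrite c0 d0 !mulr0 subrr => /eqP.
  by rewrite eq_sym oner_eq0.
have -> : mx2 a b c d = mx2 (a + b) b d d *m y (-1).
  by rewrite mx2M c0; congr mx2; ring.
rewrite SL2_actM ?det_mx2_lower ?det_mx2 -?mulmxA //; last by rewrite -det1 c0; ring.
by apply: gen; [rewrite -det1 c0; ring | | apply: Py].
Qed.

Hypothesis simpleSt : simple St.
Hypothesis highestSt : highest_weight St q.-1%:Z.

Lemma steinberg_generator : exists v : 'cV[k]_n,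
  X q.-1 *m v != 0 /\
  forall w', exists a : nat -> k, w' = \sum_(i < q) a i *: (X i *m v).
Proof.
have [[v1 nz_v1 wv1] maxw] := highestSt.
have weightP m (v : 'cV[k]_n) : v != 0 -> weight_vector m v ->
    exists j : nat, q.-1%:Z = m + 2%:Z *+ j.
  by move=> nz_v wv; apply: maxw; exists v.
have [N0 expN] := rho_u_expansion.
(* A nonzero [X i *m v1] would have weight q-1+2i, above the highest. The same count from the lowest
   weight -(q-1) gives [Xv]. *)
have Xv1 i : (0 < i)%N -> X i *m v1 = 0.
  move=> i_gt0; apply/eqP/negPn/negP => nz.
  by have [j] := weightP _ _ nz (weight_vector_X i wv1); lia.
have u_v1 t : rho (u t) *m v1 = v1.
  have [_ ->] := expN N0.+1 (leqnSn _).
  rewrite big_ord_recl big1 => [|i _]; last by rewrite Xv1 ?scaler0.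
  by rewrite expr0 scale1r addr0 SL2_X0 mul1mx.
pose v := rho w *m v1.
have nz_v : v != 0.
  apply: contra nz_v1 => /eqP v0.
  have wV : mx2 0 (-1) 1 0 *m w = 1%:M by rewrite mx2M mx2_1; congr mx2; ring.
  rewrite -[v1]mul1mx -SL2_act1 -wV SL2_actM ?det_mx2_weyl ?det_mx2 //; last by ring.
  by rewrite -mulmxA -/v v0 mulmx0.
have wv : weight_vector (- q.-1%:Z) v.
  move=> a nz_a; have nz_a' : a^-1 != 0 by rewrite invr_eq0.
  have -> : rho (torus a) *m v = rho w *m (rho (torus a^-1) *m v1).
    rewrite !mulmxA -!SL2_actM ?det_mx2_weyl ?det_torus //; congr (rho _ *m _).
    by rewrite !torus_mx2 !mx2M invrK; congr mx2; ring.
  by rewrite wv1 // -scalemxAr -/v exprz_inv.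
have Xv i : (q <= i)%N -> X i *m v = 0.
  move=> le_qi; apply/eqP/negPn/negP => nz.
  by have [j] := weightP _ _ nz (weight_vector_X i wv); lia.
have u_v t : rho (u t) *m v = \sum_(i < q) t ^+ i *: (X i *m v).
  have [_ ->] := expN (N0 + q)%N (leq_addr _ _).
  rewrite (bigID (fun i : 'I__ => (i < q)%N)) /= addrC big1 ?add0r => [|i]; last first.
    by rewrite -leqNgt => /Xv ->; rewrite scaler0.
  by rewrite (big_ord_widen _ (fun i => t ^+ i *: (X i *m v)) (leq_addl N0 q)).
have y_v s : rho (y s) *m v = v.
  rewrite /v mulmxA -SL2_actM ?det_mx2_lower ?det_mx2_weyl //.
  have -> : y s *m w = w *m u (- s) by rewrite !mx2M; congr mx2; ring.
  by rewrite SL2_actM ?det_mx2_upper ?det_mx2_weyl // -mulmxA u_v1.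
(* The coefficient of t^i in u(s) u(t) v = u(t + s) v. *)
have uX s i : (i < q)%N ->
    rho (u s) *m (X i *m v) = \sum_(l < q) (('X + s%:P) ^+ l)`_i *: (X l *m v).
  apply: (coef_matrix_eq (x := fun i => rho (u s) *m (X i *m v)) (oner_neq0 _)) => t _.
  under eq_bigr => j _ do rewrite scalemxAr.
  rewrite -mulmx_sumr -u_v mulmxA -SL2_actM ?det_mx2_upper //.
  have -> : u s *m u t = u (t + s) by rewrite mx2M; congr mx2; ring.
  by rewrite u_v; apply: eq_bigr => l _; rewrite horner_exp !hornerE.
have yX s i : (i < q)%N ->
    rho (y s) *m (X i *m v) =
    \sum_(l < q) ('X^l * (1 + s *: 'X) ^+ (q.-1 - l))`_i *: (X l *m v).
  have nzR : 1 + s *: 'X != 0 :> {poly k}.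
    by apply/eqP => /(congr1 (coefp 0)) /eqP; rewrite /coefp !coefE mulr0 addr0 oner_eq0.
  apply: (coef_matrix_eq (x := fun i => rho (y s) *m (X i *m v)) nzR) => t.
  rewrite !hornerE => nz_d; set d := 1 + s * t in nz_d.
  under eq_bigr => j _ do rewrite scalemxAr.
  rewrite -mulmx_sumr -u_v mulmxA -SL2_actM ?det_mx2_upper ?det_mx2_lower //.
  (* The big cell factorization, valid where d != 0.                       *)
  have -> : y s *m u t = u (t / d) *m (torus d^-1 *m y (s / d)).
    rewrite torus_mx2 !mx2M invrK; congr mx2; rewrite /d; field => //.
  have nz_d' : d^-1 != 0 by rewrite invr_eq0.
  rewrite !SL2_actM ?det_mulmx ?det_mx2_upper ?det_mx2_lower ?det_torus ?mulr1 //.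
  rewrite -!mulmxA y_v wv //.
  rewrite -scalemxAr u_v scaler_sumr; apply: eq_bigr => l _.
  rewrite scalerA !hornerE -/d; congr (_ *: _).
  rewrite exprz_inv opprK -exprnP expr_div_n.
  rewrite -{1}(@subnK l q.-1) ?exprD; last by have := ltn_ord l; lia.
  by rewrite mulrC mulrA mulrAC mulfVK ?expf_neq0.
have gen_v w' : exists a : nat -> k, w' = \sum_(i < q) a i *: (X i *m v).
  pose T := [tuple X i *m v | i < q].
  have memT i : (i < q)%N -> X i *m v \in <<T>>%VS.
    move=> lt_iq; apply: memv_span; apply/imageP.
    by exists (Ordinal lt_iq).
  have spanT v' : v' \in <<T>>%VS -> exists a : 'I_q -> k, v' = \sum_i a i *: (X i *m v).
    move=> /coord_span E; exists (fun i => coord T i v'); rewrite {1}E.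
    by apply: eq_bigr => i _; rewrite -tnth_nth tnth_mktuple.
  have stabT A : (forall i, (i < q)%N -> A *m (X i *m v) \in <<T>>%VS) ->
      forall v', v' \in <<T>>%VS -> A *m v' \in <<T>>%VS.
    move=> AX v' /spanT[a ->]; rewrite mulmx_sumr; apply: memv_suml => i _.
    by rewrite -scalemxAr memvZ // AX.
  have sumT (a : 'I_q -> k) : \sum_i a i *: (X i *m v) \in <<T>>%VS.
    by apply: memv_suml => i _; rewrite memvZ // memT.
  have [_ /(_ <<T>>%VS)[g v' dg||T_full]] := simpleSt.
  - apply: (@SL2_stable (fun v' => v' \in <<T>>%VS)) dg => [t|t].
      by apply: stabT => i lt_iq; rewrite uX // sumT.
    by apply: stabT => i lt_iq; rewrite yX // sumT.
  - move=> T0; have := memT 0 q_gt0; rewrite T0 SL2_X0 mul1mx memv0.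
    by rewrite (negPf nz_v).
  have /spanT[a ->] : w' \in <<T>>%VS by rewrite T_full memvf.
  exists (fun i => if insub i is Some j then a j else 0).
  by apply: eq_bigr => i _; rewrite valK.
exists v; split=> //; apply: contra nz_v => /eqP top0.
(* If [X q.-1 *m v] were 0, [yX] at i = q-1 would make the sum of the t^(q-1-l) X_l v vanish for all
   t. Reversing the order makes [x i] the coefficient of t^i, and the top one is X_0 v = v. The zero
   right-hand side is a sum over ['I_0]. *)
pose x i := X (q.-1 - i) *m v.
have lt_q : (q.-1 < q)%N by rewrite ltn_predL.
have := coef_matrix_eq (x := x) (I := 'I_0) (P := fun=> 0) (b := fun=> 0)
  (oner_neq0 _) _ lt_q.
rewrite big_ord0 /x subnn SL2_X0 mul1mx => -> // t _; rewrite big_ord0.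
have := yX t _ lt_q; rewrite top0 mulmx0 => /esym E.
rewrite -[RHS]E (reindex_inj rev_ord_inj); apply: eq_bigr => l _ /=.
have lq := ltn_ord l.
rewrite coefXnM (_ : (q.-1 < l)%N = false); last by lia.
rewrite (_ : q - l.+1 = q.-1 - l)%N; last by lia.
rewrite subKn; last by lia.
rewrite exprDn coef_sum big_ord_recr /= big1 ?add0r => [|j _].
  by rewrite subnn expr0 mul1r binn mulr1n exprZn coefZ coefXn eqxx mulr1.
rewrite expr1n mul1r coefMn exprZn coefZ coefXn.
by rewrite gtn_eqF ?ltn_ord // mulr0 mul0rn.
Qed.
End SteinbergRestriction.

Lemma coef_comp_scaleX (R : comNzRingType) (P : {poly R}) (c : R) i :
  (P \Po (c *: 'X))`_i = c ^+ i * P`_i.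
Proof.
rewrite coef_comp_poly.
rewrite -(sum_pick (q := size P) (s := i) (F := fun j => c ^+ j * P`_j)).
  apply: eq_bigr => j _; rewrite exprZn coefZ coefXn.
  by case: eqP => _; rewrite ?mulr1 ?mulr0 // mulrC.
by move=> le_Pi; rewrite nth_default ?mulr0.
Qed.

Lemma coefp_mulCmx (R : nzRingType) m n l (A : 'M[R]_(m, n)) (B : 'M[{poly R}]_(n, l)) i :
  map_mx (coefp i) (map_mx polyC A *m B) = A *m map_mx (coefp i) B.
Proof.
apply/matrixP => a b; rewrite !mxE /coefp coef_sum.
by apply: eq_bigr => c _; rewrite !mxE coefCM.
Qed.

Lemma coefp_mulmxC (R : nzRingType) m n l (A : 'M[{poly R}]_(m, n)) (B : 'M[R]_(n, l)) i :
  map_mx (coefp i) (A *m map_mx polyC B) = map_mx (coefp i) A *m B.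
Proof.
apply/matrixP => a b; rewrite !mxE /coefp coef_sum.
by apply: eq_bigr => c _; rewrite !mxE coefMC.
Qed.

(** Conjugation by [h] turns [iso] into t |-> u(e t). Conjugating the coefficient matrix and
    replacing t by t/e gives the [Z] of the standard subgroup, so the divided powers agree up to
    conjugation and the units e^(-i), and the generator is carried back by [h']. *)
Lemma steinberg_restriction (k : closedFieldType) (p r : nat) (U : closed_subgroup k)
    (iso : Ga_iso p U) (sUS : forall g, U g -> @SL2 k g) (St : rational_module (@SL2 k)) :
  (0 < p ^ r)%N -> unipotent U -> steinberg p r St ->
  let N := pullback (inclusion sUS) St in
  exists v : 'cV[k]_(rm_dim N), Ga_op iso N (p ^ r).-1 *m v != 0 /\
    forall w, exists a : nat -> k,
      w = \sum_(i < p ^ r) a i *: (Ga_op iso N i *m v).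
Proof.
set q := (p ^ r)%N => q_gt0 uniU [simpleSt highestSt] N.
have [h [h' [e [deth hh' h'h nz_e conjE]]]] := Ga_conj iso uniU.
have deth' : \det h' = 1 by rewrite -[LHS]mul1r -deth -det_mulmx hh' det1.
have actN g : rm_act N g = rm_act St g.
  by rewrite /rm_act mateval_subst mateval_coordX.
have rhoV : rm_act St h' *m rm_act St h = 1%:M by rewrite -SL2_actM // h'h SL2_act1.
pose Z : 'M[{poly k}]_(rm_dim St) := map_mx (comp_poly (e^-1 *: 'X))
  (map_mx polyC (rm_act St h) *m Ga_coef iso N *m map_mx polyC (rm_act St h')).
have rho_u t : rm_act St (mx2 1 t 0 1) = map_mx (horner_eval t) Z.
  have -> : map_mx (horner_eval t) Z = map_mx (horner_eval (e^-1 * t))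
      (map_mx polyC (rm_act St h) *m Ga_coef iso N *m map_mx polyC (rm_act St h')).
    apply/matrixP => i j; rewrite [LHS]mxE [RHS]mxE /Z [X in horner_eval t X]mxE.
    by rewrite /horner_eval horner_comp !hornerE.
  have evC (A : 'M[k]_(rm_dim St)) s : map_mx (horner_eval s) (map_mx polyC A) = A.
    by apply/matrixP => i j; rewrite !mxE /horner_eval hornerC.
  have GE s : map_mx (horner_eval s) (Ga_coef iso N : 'M_(rm_dim St)) =
      rm_act St (param_at (ga_param iso) s) by rewrite -actN -Ga_coefE.
  rewrite !map_mxM GE !evC -!SL2_actM ?det_mulmx ?deth ?deth' ?(cs_det (ga_param_in iso _))
    ?mulr1 //.
  by rewrite conjE mulVKf.
have XE i : map_mx (coefp i) Z =
    e^-1 ^+ i *: (rm_act St h *m Ga_op iso N i *m rm_act St h').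
  rewrite /Ga_op -coefp_mulCmx -coefp_mulmxC; apply/matrixP => a b.
  rewrite [LHS]mxE /Z [X in coefp i X]mxE [LHS]coef_comp_scaleX.
  by rewrite [RHS]mxE [X in _ = _ * X]mxE.
have [v [top_v gen_v]] := steinberg_generator q_gt0 rho_u simpleSt highestSt.
exists (rm_act St h' *m v); split=> [|w].
  apply: contra top_v => /eqP top0.
  by rewrite XE -scalemxAl -!mulmxA top0 mulmx0 scaler0.
have [a aE] := gen_v (rm_act St h *m w).
exists (fun i => a i * e^-1 ^+ i).
rewrite -[LHS]mul1mx -rhoV -mulmxA aE mulmx_sumr; apply: eq_bigr => i _.
rewrite -scalerA -scalemxAr XE; congr (_ *: _).
by rewrite -scalemxAl -scalemxAr !mulmxA rhoV mul1mx.
Qed.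

Theorem mainTheorem2 (k : closedFieldType) (p : nat) (charp : p \in [pchar k])
    (r : nat) (r_gt0 : (0 < r)%N)
    (B : closed_subgroup k) (borelB : borel B) (BFp : defined_over (Fq p) B)
    (U : closed_subgroup k) (radU : unipotent_radical B U) (iso : Ga_iso p U) :
  (forall St : rational_module (@SL2 k), steinberg p r St ->
     let f := artin_schreier charp iso r in
     let M := pullback f (pullback (inclusion (@cs_det k U : forall g, U g -> @SL2 k g)) St) in
     projective (Ur_module charp iso r M : lmodType (dist_algebra k (p ^ r))) /\
     (forall g : Fq_points charp r_gt0 U, rm_act M (val g) = 1%:M)) /\
  (exists M : rational_module U,
     projective (Ur_module charp iso r M : lmodType (dist_algebra k (p ^ r))) /\
     ~ projective (Fq_module charp r_gt0 M :
         lmodType (group_algebra k (Fq_points charp r_gt0 U)))).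
Proof.
have q_gt0 : (0 < p ^ r)%N by rewrite expn_gt0 prime_gt0 // (pcharf_prime charp).
have [_ uniU _ _] := radU.
split=> [St steinSt f M|].
  split; last exact: artin_schreier_trivial.
  have [v [top_v gen_v]] :=
    steinberg_restriction iso (@cs_det k U) q_gt0 uniU steinSt.
  exact: Ur_projective_artin_schreier top_v gen_v.
exists (pullback (artin_schreier charp iso r) (translation_module iso (p ^ r))).
split; first exact: translation_projective.
by apply: Fq_trivial_not_projective => //; apply: artin_schreier_trivial.
Qed.
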